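(* Let $\mathbf{L}$ be one of the logics described in the context (determined by a set $N$ of non-logical rules). If a labelled sequent $\Gamma\Rightarrow\Delta$ is $\mathbf{Q\lambda.L}$-valid, then it is $\mathbf{G3Q\lambda.L}$-derivable.
   Context: Language $\mathcal{L}^\lambda$: fix a signature of $n$-ary predicate letters and an infinite set of variables $x,y,z,\dots$. Terms and formulas are defined simultaneously: terms $t::=x\mid \iota xA$ (definite descriptions, ''the $x$ such that $A$''), formulas $A::=Px_1\dots x_n\mid x_1=x_2\mid\bot\mid A\wedge A\mid A\vee A\mid A\supset A\mid\forall xA\mid\exists xA\mid\Box A\mid\Diamond A\mid \lambda xA.t$. Thus descriptions occur in formulas only as the term of a $\lambda$-abstract. $\iota x$ binds $x$ in $A$; in $\lambda xA.t$ the occurrences of $x$ in $A$ are bound by $\lambda x$ (the displayed $t$ is not in its scope). $A[y/x]$ is the result of replacing the free occurrences of $x$ by $y$, with $y$ free for $x$. Atomic formulas are $Px_1\dots x_n$ and $x_1=x_2$. Semantics. A model is $\mathcal{M}=\langle\mathcal{W},\mathcal{R},\mathcal{D},\mathcal{V}\rangle$: $\mathcal{W}\neq\varnothing$ a set of worlds, $\mathcal{R}\subseteq\mathcal{W}\times\mathcal{W}$, $\mathcal{D}$ assigns to each $w$ a possibly empty set $D_w$ with $D_\mathcal{W}=\bigcup_w D_w$ nonempty and disjoint from $\mathcal{W}$, and $\mathcal{V}(P,w)\subseteq (D_\mathcal{W})^n$ for each $n$-ary $P$. An assignment $\sigma$ maps variables into $D_\mathcal{W}$; $\sigma^{x\triangleright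 o}$ is $\sigma$ with $x$ sent to $o$. Denotation: $\mathcal{V}^\sigma_w(x)=\sigma(x)$; $\mathcal{V}^\sigma_w(\iota xA)=o$ iff $o$ is the one and only member of $D_\mathcal{W}$ with $\sigma^{x\triangleright o}\models_w A$ (undefined otherwise). Satisfaction: $\sigma\models_w Px_1\dots x_n$ iff $\langle\sigma(x_1),\dots,\sigma(x_n)\rangle\in\mathcal{V}(P,w)$; $\sigma\models_w x=y$ iff $\sigma(x)=\sigma(y)$; $\bot$ never; Boolean connectives classical; $\sigma\models_w\forall xB$ iff $\sigma^{x\triangleright o}\models_w B$ for all $o\in D_w$; $\sigma\models_w\exists xB$ iff for some $o\in D_w$; $\sigma\models_w\Box B$ iff $\sigma\models_v B$ for all $v$ with $w\mathcal{R}v$; $\sigma\models_w\Diamond B$ iff for some such $v$; $\sigma\models_w\lambda xA.t$ iff $\mathcal{V}^\sigma_w(t)$ is defined and $\sigma^{x\triangleright\mathcal{V}^\sigma_w(t)}\models_w A$. Labelled sequents. Labels $w,v,u,\dots$ form a separate set. Expressions: labelled formulas $w:A$ ($A\in\mathcal{L}^\lambda$), domain atoms $x\in w$, relational atoms $w\mathscr{R}v$, denotation formulas $D(t,x,w)$ ($t$ a term, $x$ a variable). A sequent $\Gamma\Rightarrow\Delta$ has $\Gamma$ a multiset of labelled formulas, denotation formulas, domain atoms and relational atoms, and $\Delta$ a multiset of labelled formulas and denotation formulas. Substitutions $[y/x]$, $[w/v]$ extend componentwise. ''Fresh'' means not occurring in the conclusion of the rule. Calculus $\mathbf{G3Q\lambda.K}$.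 Initial sequents: $w:p,\Gamma\Rightarrow\Delta,w:p$ ($p$ atomic); $D(y,x,w),\Gamma\Rightarrow\Delta,D(y,x,w)$ ($y$ a variable); $w:\bot,\Gamma\Rightarrow\Delta$. Propositional rules (all at one label $w$): $L\wedge$: from $w:A,w:B,\Gamma\Rightarrow\Delta$ infer $w:A\wedge B,\Gamma\Rightarrow\Delta$; $R\wedge$: from $\Gamma\Rightarrow\Delta,w:A$ and $\Gamma\Rightarrow\Delta,w:B$ infer $\Gamma\Rightarrow\Delta,w:A\wedge B$; $L\vee$: from $w:A,\Gamma\Rightarrow\Delta$ and $w:B,\Gamma\Rightarrow\Delta$ infer $w:A\vee B,\Gamma\Rightarrow\Delta$; $R\vee$: from $\Gamma\Rightarrow\Delta,w:A,w:B$ infer $\Gamma\Rightarrow\Delta,w:A\vee B$; $L\supset$: from $\Gamma\Rightarrow\Delta,w:A$ and $w:B,\Gamma\Rightarrow\Delta$ infer $w:A\supset B,\Gamma\Rightarrow\Delta$; $R\supset$: from $w:A,\Gamma\Rightarrow\Delta,w:B$ infer $\Gamma\Rightarrow\Delta,w:A\supset B$. Quantifiers: $L\forall$: from $w:A[y/x],y\in w,w:\forall xA,\Gamma\Rightarrow\Delta$ infer $y\in w,w:\forall xA,\Gamma\Rightarrow\Delta$; $R\forall$ ($z$ fresh): from $z\in w,\Gamma\Rightarrow\Delta,w:A[z/x]$ infer $\Gamma\Rightarrow\Delta,w:\forall xA$; $L\exists$ ($z$ fresh): from $z\in w,w:A[z/x],\Gamma\Rightarrow\Delta$ infer $w:\exists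 xA,\Gamma\Rightarrow\Delta$; $R\exists$: from $y\in w,\Gamma\Rightarrow\Delta,w:\exists xA,w:A[y/x]$ infer $y\in w,\Gamma\Rightarrow\Delta,w:\exists xA$. Modalities: $L\Box$: from $v:A,w\mathscr{R}v,w:\Box A,\Gamma\Rightarrow\Delta$ infer $w\mathscr{R}v,w:\Box A,\Gamma\Rightarrow\Delta$; $R\Box$ ($u$ fresh): from $w\mathscr{R}u,\Gamma\Rightarrow\Delta,u:A$ infer $\Gamma\Rightarrow\Delta,w:\Box A$; $L\Diamond$ ($u$ fresh): from $w\mathscr{R}u,u:A,\Gamma\Rightarrow\Delta$ infer $w:\Diamond A,\Gamma\Rightarrow\Delta$; $R\Diamond$: from $w\mathscr{R}v,\Gamma\Rightarrow\Delta,w:\Diamond A,v:A$ infer $w\mathscr{R}v,\Gamma\Rightarrow\Delta,w:\Diamond A$. Identity: $Ref_=$: from $w:x=x,\Gamma\Rightarrow\Delta$ infer $\Gamma\Rightarrow\Delta$; $RigVar$: from $v:y=z,w:y=z,\Gamma\Rightarrow\Delta$ infer $w:y=z,\Gamma\Rightarrow\Delta$; $Repl$: from $E[z/x],E[y/x],w:y=z,\Gamma\Rightarrow\Delta$ infer $E[y/x],w:y=z,\Gamma\Rightarrow\Delta$, where $E$ is a denotation formula with variable first argument and label $w$, a domain atom $x'\in w$, or a labelled atomic formula $w:p$. $\lambda$: $L\lambda$ ($z$ fresh): from $D(t,z,w),w:B[z/x],\Gamma\Rightarrow\Delta$ infer $w:\lambda xB.t,\Gamma\Rightarrow\Delta$;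 $R\lambda$: from $\Gamma\Rightarrow\Delta,w:\lambda xB.t,D(t,y,w)$ and $\Gamma\Rightarrow\Delta,w:\lambda xB.t,w:B[y/x]$ infer $\Gamma\Rightarrow\Delta,w:\lambda xB.t$. Denotation: $LD_1$: from $w:A[x_2/x_1],D(\iota x_1A,x_2,w),\Gamma\Rightarrow\Delta$ infer $D(\iota x_1A,x_2,w),\Gamma\Rightarrow\Delta$; $LD_2$: from $D(\iota x_1A,x_2,w),\Gamma\Rightarrow\Delta,w:A[y/x_1]$ and $w:x_2=y,D(\iota x_1A,x_2,w),\Gamma\Rightarrow\Delta$ infer $D(\iota x_1A,x_2,w),\Gamma\Rightarrow\Delta$; $RD$ ($z$ fresh): from $\Gamma\Rightarrow\Delta,w:A[x_2/x_1]$ and $w:A[z/x_1],\Gamma\Rightarrow\Delta,w:x_2=z$ infer $\Gamma\Rightarrow\Delta,D(\iota x_1A,x_2,w)$; $DenVar$: from $D(x,x,w),\Gamma\Rightarrow\Delta$ infer $\Gamma\Rightarrow\Delta$; $DenId$: from $w:y=x,D(y,x,w),\Gamma\Rightarrow\Delta$ infer $D(y,x,w),\Gamma\Rightarrow\Delta$ ($x,y$ variables). Non-logical rules: $Ref_\mathcal{W}$: from $w\mathscr{R}w,\Gamma\Rightarrow\Delta$ infer $\Gamma\Rightarrow\Delta$ (reflexivity); $Ser$ ($u$ fresh): from $w\mathscr{R}u,\Gamma\Rightarrow\Delta$ infer $\Gamma\Rightarrow\Delta$ (seriality); $Trans$: from $w\mathscr{R}u,w\mathscr{R}v,v\mathscr{R}u,\Gamma\Rightarrow\Delta$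 infer $w\mathscr{R}v,v\mathscr{R}u,\Gamma\Rightarrow\Delta$ (transitivity); $Eucl$: from $v\mathscr{R}u,w\mathscr{R}v,w\mathscr{R}u,\Gamma\Rightarrow\Delta$ infer $w\mathscr{R}v,w\mathscr{R}u,\Gamma\Rightarrow\Delta$, always together with $Eucl^c$: from $v\mathscr{R}v,w\mathscr{R}v,\Gamma\Rightarrow\Delta$ infer $w\mathscr{R}v,\Gamma\Rightarrow\Delta$ (Euclideanness); $Incr$: from $x\in v,x\in w,w\mathscr{R}v,\Gamma\Rightarrow\Delta$ infer $x\in w,w\mathscr{R}v,\Gamma\Rightarrow\Delta$ (increasing domains: $w\mathcal{R}v\Rightarrow D_w\subseteq D_v$); $Decr$: from $x\in w,x\in v,w\mathscr{R}v,\Gamma\Rightarrow\Delta$ infer $x\in v,w\mathscr{R}v,\Gamma\Rightarrow\Delta$ (decreasing domains); $Cons$: from $x\in w,\Gamma\Rightarrow\Delta$ infer $\Gamma\Rightarrow\Delta$ (constant domains: $w\mathcal{R}v\Rightarrow D_w=D_v$). For a set $N$ of these non-logical rules, $\mathbf{G3Q\lambda.L}=\mathbf{G3Q\lambda.K}+N$, and $\mathbf{Q\lambda.L}$ is the logic of the class of frames $\langle\mathcal{W},\mathcal{R},\mathcal{D}\rangle$ satisfying the corresponding properties; a model for $\mathbf{Q\lambda.L}$ is one based on such a frame. Derivations: trees of sequents with initial sequents at the leaves, built by the rules, of pure sequents (no variable both free and bound). $\Gamma\Rightarrow\Delta$ is derivable if it or an alphabetic variant has a derivation. Validity: for a model $\mathcal{M}$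 and $f$ mapping labels to worlds and variables to $D_\mathcal{W}$: $\mathcal{M}$ satisfies $w:A$ under $f$ iff $f\models_{f(w)}A$; $x\in w$ iff $f(x)\in D_{f(w)}$; $w\mathscr{R}v$ iff $f(w)\mathcal{R}f(v)$; $D(t,x,w)$ iff $f(t)=f(x)$ when $t$ is a variable, and, when $t\equiv\iota yA$, iff for all $o\in D_\mathcal{W}$: $f^{y\triangleright o}\models_{f(w)}A$ iff $o=f(x)$. $\Gamma\Rightarrow\Delta$ is $\mathbf{Q\lambda.L}$-valid iff for every model $\mathcal{M}$ for $\mathbf{Q\lambda.L}$ and every $f$, if $\mathcal{M}$ satisfies all of $\Gamma$ under $f$ then it satisfies some member of $\Delta$ under $f$. *)

(* Defs.v *)
From Stdlib Require Export Permutation.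
From mathcomp Require Export all_boot.

Set Implicit Arguments.
Unset Strict Implicit.
Unset Printing Implicit Defensive.

Definition infinite_type (T : eqType) := forall s : seq T, exists x, x \notin s.

Record signature := Signature { letter : Type; arity : letter -> nat }.

Section Syntax.
Variables (S : signature) (V : eqType).

Inductive form :=
| Atom (P : letter S) (xs : (arity P).-tuple V)
| Eq (x y : V)
| Bot
| And (A B : form)
| Or (A B : form)
| Imp (A B : form)
| All (x : V) (A : form)
| Ex (x : V) (A : form)
| Box (A : form)
| Dia (A : form)
| Lam (x : V) (A : form) (t : term)
with term :=
| Var (x : V)
| Iota (x : V) (A : form).

Inductive atomic : form -> Prop :=
| atomic_Atom P (xs : (arity P).-tuple V) : atomic (Atom xs)
| atomic_Eq x y : atomic (Eq x y).

Definition vsubst (y x z : V) : V := if z == x then y else z.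

(* [fsubst y x A] is A[y/x].  Nothing is renamed, so this is the intended
   operation only when y is free for x in A.  This holds at every use below:
   in [alpha], y does not occur in A; in a [derivation] all sequents are pure,
   and in every rule that substitutes y, either y is free in the conclusion or
   in a premise that contains A, or y does not occur in the conclusion. *)
Fixpoint fsubst (y x : V) (A : form) : form :=
  match A with
  | Atom P xs => Atom (map_tuple (vsubst y x) xs)
  | Eq x1 x2 => Eq (vsubst y x x1) (vsubst y x x2)
  | Bot => Bot
  | And B C => And (fsubst y x B) (fsubst y x C)
  | Or B C => Or (fsubst y x B) (fsubst y x C)
  | Imp B C => Imp (fsubst y x B) (fsubst y x C)
  | All z B => All z (if z == x then B else fsubst y x B)
  | Ex z B => Ex z (if z == x then B else fsubst y x B)
  | Box B => Box (fsubst y x B)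
  | Dia B => Dia (fsubst y x B)
  | Lam z B t => Lam z (if z == x then B else fsubst y x B) (tsubst y x t)
  end
with tsubst (y x : V) (t : term) : term :=
  match t with
  | Var z => Var (vsubst y x z)
  | Iota z B => Iota z (if z == x then B else fsubst y x B)
  end.

Fixpoint ffv (A : form) : seq V :=
  match A with
  | Atom P xs => xs
  | Eq x y => [:: x; y]
  | Bot => [::]
  | And B C | Or B C | Imp B C => ffv B ++ ffv C
  | All x B | Ex x B => [seq z <- ffv B | z != x]
  | Box B | Dia B => ffv B
  | Lam x B t => [seq z <- ffv B | z != x] ++ tfv t
  end
with tfv (t : term) : seq V :=
  match t with
  | Var x => [:: x]
  | Iota x B => [seq z <- ffv B | z != x]
  end.

(* A binder counts as bound even if it binds nothing: [pure] and freshness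
   must see it. *)
Fixpoint fbv (A : form) : seq V :=
  match A with
  | Atom _ _ | Eq _ _ | Bot => [::]
  | And B C | Or B C | Imp B C => fbv B ++ fbv C
  | All x B | Ex x B => x :: fbv B
  | Box B | Dia B => fbv B
  | Lam x B t => x :: fbv B ++ tbv t
  end
with tbv (t : term) : seq V :=
  match t with
  | Var _ => [::]
  | Iota x B => x :: fbv B
  end.

Definition fvars (A : form) : seq V := ffv A ++ fbv A.

(* Alphabetic variants: the congruence generated by renaming a bound variable
   to one that does not occur in the scope. *)
Inductive alpha : form -> form -> Prop :=
| alpha_refl A : alpha A A
| alpha_sym A B : alpha A B -> alpha B A
| alpha_trans A B C : alpha A B -> alpha B C -> alpha A C
| alpha_And A A' B B' : alpha A A' -> alpha B B' -> alpha (And A B) (And A' B')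
| alpha_Or A A' B B' : alpha A A' -> alpha B B' -> alpha (Or A B) (Or A' B')
| alpha_Imp A A' B B' : alpha A A' -> alpha B B' -> alpha (Imp A B) (Imp A' B')
| alpha_All x A A' : alpha A A' -> alpha (All x A) (All x A')
| alpha_Ex x A A' : alpha A A' -> alpha (Ex x A) (Ex x A')
| alpha_Box A A' : alpha A A' -> alpha (Box A) (Box A')
| alpha_Dia A A' : alpha A A' -> alpha (Dia A) (Dia A')
| alpha_Lam x A A' t t' :
    alpha A A' -> alphat t t' -> alpha (Lam x A t) (Lam x A' t')
| rename_All x y A : y \notin fvars A -> alpha (All x A) (All y (fsubst y x A))
| rename_Ex x y A : y \notin fvars A -> alpha (Ex x A) (Ex y (fsubst y x A))
| rename_Lam x y A t :
    y \notin fvars A -> alpha (Lam x A t) (Lam y (fsubst y x A) t)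
with alphat : term -> term -> Prop :=
| alphat_refl t : alphat t t
| alphat_sym t u : alphat t u -> alphat u t
| alphat_trans t u v : alphat t u -> alphat u v -> alphat t v
| alphat_Iota x A A' : alpha A A' -> alphat (Iota x A) (Iota x A')
| rename_Iota x y A :
    y \notin fvars A -> alphat (Iota x A) (Iota y (fsubst y x A)).

End Syntax.

Arguments Eq {S V} x y.
Arguments Bot {S V}.
Arguments Var {S V} x.

(* [obj] is the union of the domains ([obj_cover]); it is disjoint from the
   worlds because the two are separate types. *)
Record frame := Frame {
  world : Type;
  acc : world -> world -> Prop;
  obj : Type;
  dom : world -> obj -> Prop;
  world_inhabited : inhabited world;
  obj_inhabited : inhabited obj;
  obj_cover : forall o, exists w, dom w o }.

Record model (S : signature) := Model {
  model_frame :> frame;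
  interp : forall P : letter S,
    world model_frame -> (arity P).-tuple (obj model_frame) -> Prop }.

Section Semantics.
Variables (S : signature) (V : eqType) (M : model S).

Definition assignment := V -> obj M.

Definition upd (s : assignment) (x : V) (o : obj M) : assignment :=
  fun y => if y == x then o else s y.

(* [denotes s w t o]: the partial value of t at w under s is defined and is o. *)
Fixpoint sat (s : assignment) (w : world M) (A : form S V) {struct A} : Prop :=
  match A with
  | Atom P xs => interp w (map_tuple s xs)
  | Eq x y => s x = s y
  | Bot => False
  | And B C => sat s w B /\ sat s w C
  | Or B C => sat s w B \/ sat s w C
  | Imp B C => sat s w B -> sat s w C
  | All x B => forall o, dom w o -> sat (upd s x o) w B
  | Ex x B => exists2 o, dom w o & sat (upd s x o) w B
  | Box B => forall v, acc w v -> sat s v B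
  | Dia B => exists2 v, acc w v & sat s v B
  | Lam x B t => exists2 o, denotes s w t o & sat (upd s x o) w B
  end
with denotes (s : assignment) (w : world M) (t : term S V) (o : obj M)
    {struct t} : Prop :=
  match t with
  | Var x => s x = o
  | Iota x B =>
      sat (upd s x o) w B /\ forall o', sat (upd s x o') w B -> o' = o
  end.

End Semantics.

Section Sequents.
Variables (S : signature) (V L : eqType).

(* Expressions allowed on both sides: w : A and D(t,x,w). *)
Inductive sexpr :=
| Lab (w : L) (A : form S V)
| Den (t : term S V) (x : V) (w : L).

(* Expressions allowed on the left: the above, x \in w, and w R v. *)
Inductive aexpr :=
| Inj (e : sexpr)
| Mem (x : V) (w : L)
| Rel (w v : L).

(* The two multisets are represented by lists; [derivation] below works up to
   permutation. *)
Definition sequent : Type := (seq aexpr * seq sexpr)%type.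

Definition sexpr_fv e := match e with Lab _ A => ffv A | Den t x _ => x :: tfv t end.
Definition sexpr_bv e := match e with Lab _ A => fbv A | Den t _ _ => tbv t end.
Definition sexpr_labels e := match e with Lab w _ | Den _ _ w => [:: w] end.

Definition aexpr_fv e :=
  match e with Inj e => sexpr_fv e | Mem x _ => [:: x] | Rel _ _ => [::] end.
Definition aexpr_bv e :=
  match e with Inj e => sexpr_bv e | Mem _ _ | Rel _ _ => [::] end.
Definition aexpr_labels e :=
  match e with Inj e => sexpr_labels e | Mem _ w => [:: w] | Rel w v => [:: w; v] end.

Definition sequent_fv (s : sequent) : seq V :=
  flatten (map aexpr_fv s.1) ++ flatten (map sexpr_fv s.2).
Definition sequent_bv (s : sequent) : seq V :=
  flatten (map aexpr_bv s.1) ++ flatten (map sexpr_bv s.2).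
Definition sequent_labels (s : sequent) : seq L :=
  flatten (map aexpr_labels s.1) ++ flatten (map sexpr_labels s.2).

Definition pure (s : sequent) :=
  forall x, x \in sequent_fv s -> x \notin sequent_bv s.

Definition fresh_var (z : V) (s : sequent) :=
  z \notin sequent_fv s ++ sequent_bv s.
Definition fresh_label (u : L) (s : sequent) := u \notin sequent_labels s.

Definition sexpr_subst (y x : V) (e : sexpr) : sexpr :=
  match e with
  | Lab w A => Lab w (fsubst y x A)
  | Den t z w => Den (tsubst y x t) (vsubst y x z) w
  end.

Definition aexpr_subst (y x : V) (e : aexpr) : aexpr :=
  match e with
  | Inj e => Inj (sexpr_subst y x e)
  | Mem z w => Mem (vsubst y x z) w
  | Rel w v => Rel w v
  end.

(* The expressions E on which Repl may act at label w. *)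
Inductive replaceable (w : L) : aexpr -> Prop :=
| repl_Den a b : replaceable w (Inj (Den (Var a) b w))
| repl_Mem a : replaceable w (Mem a w)
| repl_Lab p : atomic p -> replaceable w (Inj (Lab w p)).

Inductive salpha : sexpr -> sexpr -> Prop :=
| salpha_Lab w A A' : alpha A A' -> salpha (Lab w A) (Lab w A')
| salpha_Den t t' x w : alphat t t' -> salpha (Den t x w) (Den t' x w).

Inductive aalpha : aexpr -> aexpr -> Prop :=
| aalpha_Inj e e' : salpha e e' -> aalpha (Inj e) (Inj e')
| aalpha_Mem x w : aalpha (Mem x w) (Mem x w)
| aalpha_Rel w v : aalpha (Rel w v) (Rel w v).

Definition sequent_alpha (s s' : sequent) :=
  List.Forall2 aalpha s.1 s'.1 /\ List.Forall2 salpha s.2 s'.2.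

End Sequents.

Arguments Mem {S V L} x w.
Arguments Rel {S V L} w v.

(* [Eucl] stands for the pair of rules Eucl and Eucl^c. *)
Inductive nlrule := RefW | Ser | Trans | Eucl | Incr | Decr | Cons.

Section Calculus.
Variables (S : signature) (V L : eqType) (N : nlrule -> Prop).

Local Notation aseq := (seq (aexpr S V L)).
Local Notation sseq := (seq (sexpr S V L)).
Local Notation "w ∶ A" := (Lab w A) (at level 59, no associativity).
Local Notation "w ∶' A" := (Inj (Lab w A)) (at level 59, no associativity).
Local Notation D := (@Den S V L).
Local Notation D' t x w := (Inj (Den t x w)).
Local Notation "G ⇒ H" := (@pair aseq sseq G H) (at level 70, no associativity).

(* [rule ps s]: s follows from the list of premises ps by one rule of
   G3Qλ.K + N, initial sequents being the rules without premises.  Primed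
   notations are the antecedent copies of the unprimed ones. *)
Inductive rule : seq (sequent S V L) -> sequent S V L -> Prop :=
| init_atom w p Γ Δ : atomic p ->
    rule [::] (w ∶' p :: Γ ⇒ w ∶ p :: Δ)
| init_Den y x w Γ Δ :
    rule [::] (D' (Var y) x w :: Γ ⇒ D (Var y) x w :: Δ)
| init_Bot w Γ Δ :
    rule [::] (w ∶' Bot :: Γ ⇒ Δ)
| LAnd w A B Γ Δ :
    rule [:: w ∶' A :: w ∶' B :: Γ ⇒ Δ]
         (w ∶' And A B :: Γ ⇒ Δ)
| RAnd w A B Γ Δ :
    rule [:: Γ ⇒ w ∶ A :: Δ; Γ ⇒ w ∶ B :: Δ]
         (Γ ⇒ w ∶ And A B :: Δ)
| LOr w A B Γ Δ :
    rule [:: w ∶' A :: Γ ⇒ Δ; w ∶' B :: Γ ⇒ Δ]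
         (w ∶' Or A B :: Γ ⇒ Δ)
| ROr w A B Γ Δ :
    rule [:: Γ ⇒ w ∶ A :: w ∶ B :: Δ]
         (Γ ⇒ w ∶ Or A B :: Δ)
| LImp w A B Γ Δ :
    rule [:: Γ ⇒ w ∶ A :: Δ; w ∶' B :: Γ ⇒ Δ]
         (w ∶' Imp A B :: Γ ⇒ Δ)
| RImp w A B Γ Δ :
    rule [:: w ∶' A :: Γ ⇒ w ∶ B :: Δ]
         (Γ ⇒ w ∶ Imp A B :: Δ)
| LAll w x y A Γ Δ :
    rule [:: w ∶' fsubst y x A :: Mem y w :: w ∶' All x A :: Γ ⇒ Δ]
         (Mem y w :: w ∶' All x A :: Γ ⇒ Δ)
| RAll w x z A Γ Δ : fresh_var z (Γ ⇒ w ∶ All x A :: Δ) ->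
    rule [:: Mem z w :: Γ ⇒ w ∶ fsubst z x A :: Δ]
         (Γ ⇒ w ∶ All x A :: Δ)
| LEx w x z A Γ Δ : fresh_var z (w ∶' Ex x A :: Γ ⇒ Δ) ->
    rule [:: Mem z w :: w ∶' fsubst z x A :: Γ ⇒ Δ]
         (w ∶' Ex x A :: Γ ⇒ Δ)
| REx w x y A Γ Δ :
    rule [:: Mem y w :: Γ ⇒ w ∶ Ex x A :: w ∶ fsubst y x A :: Δ]
         (Mem y w :: Γ ⇒ w ∶ Ex x A :: Δ)
| LBox w v A Γ Δ :
    rule [:: v ∶' A :: Rel w v :: w ∶' Box A :: Γ ⇒ Δ]
         (Rel w v :: w ∶' Box A :: Γ ⇒ Δ)
| RBox w u A Γ Δ : fresh_label u (Γ ⇒ w ∶ Box A :: Δ) ->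
    rule [:: Rel w u :: Γ ⇒ u ∶ A :: Δ]
         (Γ ⇒ w ∶ Box A :: Δ)
| LDia w u A Γ Δ : fresh_label u (w ∶' Dia A :: Γ ⇒ Δ) ->
    rule [:: Rel w u :: u ∶' A :: Γ ⇒ Δ]
         (w ∶' Dia A :: Γ ⇒ Δ)
| RDia w v A Γ Δ :
    rule [:: Rel w v :: Γ ⇒ w ∶ Dia A :: v ∶ A :: Δ]
         (Rel w v :: Γ ⇒ w ∶ Dia A :: Δ)
| RefEq w x Γ Δ :
    rule [:: w ∶' Eq x x :: Γ ⇒ Δ]
         (Γ ⇒ Δ)
| RigVar w v y z Γ Δ :
    rule [:: v ∶' Eq y z :: w ∶' Eq y z :: Γ ⇒ Δ]
         (w ∶' Eq y z :: Γ ⇒ Δ)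
| Repl w x y z E Γ Δ : replaceable w E ->
    rule [:: aexpr_subst z x E :: aexpr_subst y x E :: w ∶' Eq y z :: Γ ⇒ Δ]
         (aexpr_subst y x E :: w ∶' Eq y z :: Γ ⇒ Δ)
| LLam w x z B t Γ Δ : fresh_var z (w ∶' Lam x B t :: Γ ⇒ Δ) ->
    rule [:: D' t z w :: w ∶' fsubst z x B :: Γ ⇒ Δ]
         (w ∶' Lam x B t :: Γ ⇒ Δ)
| RLam w x y B t Γ Δ :
    rule [:: Γ ⇒ w ∶ Lam x B t :: D t y w :: Δ;
             Γ ⇒ w ∶ Lam x B t :: w ∶ fsubst y x B :: Δ]
         (Γ ⇒ w ∶ Lam x B t :: Δ)
| LD1 w x1 x2 A Γ Δ :
    rule [:: w ∶' fsubst x2 x1 A :: D' (Iota x1 A) x2 w :: Γ ⇒ Δ]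
         (D' (Iota x1 A) x2 w :: Γ ⇒ Δ)
| LD2 w x1 x2 y A Γ Δ :
    rule [:: D' (Iota x1 A) x2 w :: Γ ⇒ w ∶ fsubst y x1 A :: Δ;
             w ∶' Eq x2 y :: D' (Iota x1 A) x2 w :: Γ ⇒ Δ]
         (D' (Iota x1 A) x2 w :: Γ ⇒ Δ)
| RD w x1 x2 z A Γ Δ : fresh_var z (Γ ⇒ D (Iota x1 A) x2 w :: Δ) ->
    rule [:: Γ ⇒ w ∶ fsubst x2 x1 A :: Δ;
             w ∶' fsubst z x1 A :: Γ ⇒ w ∶ Eq x2 z :: Δ]
         (Γ ⇒ D (Iota x1 A) x2 w :: Δ)
| DenVar w x Γ Δ :
    rule [:: D' (Var x) x w :: Γ ⇒ Δ]
         (Γ ⇒ Δ)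
| DenId w x y Γ Δ :
    rule [:: w ∶' Eq y x :: D' (Var y) x w :: Γ ⇒ Δ]
         (D' (Var y) x w :: Γ ⇒ Δ)
| rule_RefW w Γ Δ : N RefW ->
    rule [:: Rel w w :: Γ ⇒ Δ]
         (Γ ⇒ Δ)
| rule_Ser w u Γ Δ : N Ser -> fresh_label u (Γ ⇒ Δ) ->
    rule [:: Rel w u :: Γ ⇒ Δ]
         (Γ ⇒ Δ)
| rule_Trans w v u Γ Δ : N Trans ->
    rule [:: Rel w u :: Rel w v :: Rel v u :: Γ ⇒ Δ]
         (Rel w v :: Rel v u :: Γ ⇒ Δ)
| rule_Eucl w v u Γ Δ : N Eucl ->
    rule [:: Rel v u :: Rel w v :: Rel w u :: Γ ⇒ Δ]
         (Rel w v :: Rel w u :: Γ ⇒ Δ)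
| rule_Euclc w v Γ Δ : N Eucl ->
    rule [:: Rel v v :: Rel w v :: Γ ⇒ Δ]
         (Rel w v :: Γ ⇒ Δ)
| rule_Incr x w v Γ Δ : N Incr ->
    rule [:: Mem x v :: Mem x w :: Rel w v :: Γ ⇒ Δ]
         (Mem x w :: Rel w v :: Γ ⇒ Δ)
| rule_Decr x w v Γ Δ : N Decr ->
    rule [:: Mem x w :: Mem x v :: Rel w v :: Γ ⇒ Δ]
         (Mem x v :: Rel w v :: Γ ⇒ Δ)
| rule_Cons x w Γ Δ : N Cons ->
    rule [:: Mem x w :: Γ ⇒ Δ]
         (Γ ⇒ Δ).

Inductive derivation : sequent S V L -> Prop :=
| derivation_step ps Γ Δ Γ' Δ' :
    Permutation Γ Γ' -> Permutation Δ Δ' -> pure (Γ' ⇒ Δ') ->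
    rule ps (Γ ⇒ Δ) -> (forall p, List.In p ps -> derivation p) ->
    derivation (Γ' ⇒ Δ').

Definition derivable (s : sequent S V L) :=
  exists2 s', sequent_alpha s s' & derivation s'.

End Calculus.

Definition frame_property (F : frame) (n : nlrule) : Prop :=
  match n with
  | RefW => forall w : world F, acc w w
  | Ser => forall w : world F, exists u, acc w u
  | Trans => forall w v u : world F, acc w v -> acc v u -> acc w u
  | Eucl => forall w v u : world F, acc w v -> acc w u -> acc v u
  | Incr => forall w v : world F, acc w v -> forall o, dom w o -> dom v o
  | Decr => forall w v : world F, acc w v -> forall o, dom v o -> dom w o
  | Cons => forall w v : world F, acc w v -> forall o, dom w o <-> dom v o
  end.

Section Validity.
Variables (S : signature) (V L : eqType).

Section Satisfaction.
Variables (M : model S) (fL : L -> world M) (fV : V -> obj M).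

Definition sexpr_sat (e : sexpr S V L) : Prop :=
  match e with
  | Lab w A => sat fV (fL w) A
  | Den (Var y) x w => fV y = fV x
  | Den (Iota y A) x w => forall o, sat (upd fV y o) (fL w) A <-> o = fV x
  end.

Definition aexpr_sat (e : aexpr S V L) : Prop :=
  match e with
  | Inj e => sexpr_sat e
  | Mem x w => dom (fL w) (fV x)
  | Rel w v => acc (fL w) (fL v)
  end.

End Satisfaction.

Definition valid (N : nlrule -> Prop) (s : sequent S V L) :=
  forall M : model S, (forall n, N n -> frame_property M n) ->
  forall (fL : L -> world M) (fV : V -> obj M),
    (forall e, List.In e s.1 -> aexpr_sat fL fV e) ->
    exists2 e, List.In e s.2 & sexpr_sat fL fV e.

End Validity.

(* Main.v *)
From Stdlib Require Import Classical ClassicalEpsilon FunctionalExtensionality.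
From Stdlib Require Import PropExtensionality.
Require Import Defs.

(* A pure underivable sequent is refuted by a countermodel read off an infinite
   branch of a fair proof search.  Along the branch only the current sequent is
   required to be underivable: each stage also keeps a list of everything that
   has occurred so far, and every member of that list is either still in the
   sequent or has already been decomposed.  The list grows, while a decomposed
   formula is dropped from the sequent just as the rule drops it, so that neither
   weakening nor contraction of the calculus is needed.  Every instance of a rule
   concerns at most two members of the list, hence each stage has finitely many
   requirements, and the union of the lists is saturated.  In the countermodel
   the objects are the variables modulo the equations on the left. *)

Set Implicit Arguments.
Unset Strict Implicit.
Unset Printing Implicit Defensive.

(* Derivations consist of pure sequents and [fsubst] renames nothing. A list [B] of bound variables
   is therefore fixed at the start and reserved for binders, while every free variable,
   eigenvariables included, stays outside it; this keeps all sequents of the search pure and all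
   substitutions free of capture. [V] and [L] need not be countable, so fairness cannot rest on an
   enumeration of all rule instances: at each stage the pairs from the current finite list are
   served, and only variables and labels that have occurred are used as instances. Since contraction
   is not at hand, a rule with two principal expressions does not apply to one copy of a single
   expression; each such coincidence has to be settled separately when the countermodel is
   checked. *)
Scheme form_term_ind := Induction for form Sort Prop
  with term_form_ind := Induction for term Sort Prop.
Combined Scheme syntax_ind from form_term_ind, term_form_ind.

Scheme alpha_alphat_ind := Minimality for alpha Sort Prop
  with alphat_alpha_ind := Minimality for alphat Sort Prop.
Combined Scheme alpha_mutind from alpha_alphat_ind, alphat_alpha_ind.

(** * Substitution and alphabetic variants *)

Section Substitution.
Variables (S : signature) (V : eqType).
Implicit Types (A : form S V) (t : term S V) (x y z : V).

Lemma bv_subst y x :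
  (forall A, fbv (fsubst y x A) = fbv A) /\
  (forall t, tbv (tsubst y x t) = tbv t).
Proof.
apply: syntax_ind => //=.
- by move=> A -> B ->.
- by move=> A -> B ->.
- by move=> A -> B ->.
- by move=> z A IH; case: ifP; rewrite ?IH.
- by move=> z A IH; case: ifP; rewrite ?IH.
- by move=> z A IH t ->; case: ifP; rewrite ?IH.
- by move=> z A IH; case: ifP; rewrite ?IH.
Qed.

(** Only an upper bound, so that capture and a missing [x] need no separate treatment. *)
Lemma fv_subst y x :
  (forall A, {subset ffv (fsubst y x A) <= y :: [seq z <- ffv A | z != x]}) /\
  (forall t, {subset tfv (tsubst y x t) <= y :: [seq z <- tfv t | z != x]}).
Proof.
have vs z : vsubst y x z \in y :: [seq u <- [:: z] | u != x].
  by rewrite /vsubst /=; case: (z =P x) => /= _; rewrite !inE eqxx ?orbT.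
have sub2 (s1 s2 s1' s2' : seq V) :
    {subset s1' <= y :: [seq z <- s1 | z != x]} ->
    {subset s2' <= y :: [seq z <- s2 | z != x]} ->
    {subset s1' ++ s2' <= y :: [seq z <- s1 ++ s2 | z != x]}.
  move=> h1 h2 z; rewrite mem_cat inE mem_filter mem_cat => /orP[/h1|/h2];
  by rewrite inE mem_filter => /orP[->//|/andP[-> ->]]; rewrite ?orbT.
have sub1 z (s s' : seq V) :
    {subset s' <= y :: [seq z <- s | z != x]} ->
    {subset [seq u <- (if z == x then s else s') | u != z] <=
            y :: [seq u <- [seq u <- s | u != z] | u != x]}.
  move=> h u; rewrite inE !mem_filter; case: (z =P x) => [->|_] /andP[-> us].
    by rewrite us orbT.
  by move: (h _ us); rewrite inE mem_filter.
apply: syntax_ind => //=; try by move=> *; apply: sub2.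
- move=> P xs z /mapP[u uxs ->]; rewrite inE mem_filter /vsubst.
  by case: (u =P x) => [_|/eqP ->]; rewrite ?eqxx ?uxs ?orbT.
- move=> a b; apply: (@sub2 [:: a] [:: b] [:: vsubst y x a] [:: vsubst y x b]).
    by move=> u; rewrite inE => /eqP->; apply: vs.
  by move=> u; rewrite inE => /eqP->; apply: vs.
- by move=> z A IH; have := sub1 z _ _ IH; case: ifP.
- by move=> z A IH; have := sub1 z _ _ IH; case: ifP.
- by move=> z A IH t IHt; apply: sub2 => //; have := sub1 z _ _ IH; case: ifP.
- by move=> z u; rewrite inE => /eqP->; apply: vs.
- by move=> z A IH; have := sub1 z _ _ IH; case: ifP.
Qed.

(** Inner binders are renamed first: [alpha] only renames to a variable absent from the scope, so
    the new name is chosen outside both [F] and the scope already renamed. *)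
Lemma pure_variant (V_infinite : infinite_type V) (F : seq V) :
  (forall A, exists A', [/\ alpha A A', {subset ffv A' <= ffv A}
     & forall z, z \in fbv A' -> z \notin F]) /\
  (forall t, exists t', [/\ alphat t t', {subset tfv t' <= tfv t}
     & forall z, z \in tbv t' -> z \notin F]).
Proof.
have sub2 (s1 s2 s1' s2' : seq V) : {subset s1' <= s1} -> {subset s2' <= s2} ->
    {subset s1' ++ s2' <= s1 ++ s2}.
  by move=> h1 h2 z; rewrite !mem_cat => /orP[/h1->|/h2->]; rewrite ?orbT.
have av2 (s1 s2 : seq V) : (forall z, z \in s1 -> z \notin F) ->
    (forall z, z \in s2 -> z \notin F) -> forall z, z \in s1 ++ s2 -> z \notin F.
  by move=> h1 h2 z; rewrite mem_cat => /orP[/h1|/h2].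
have bnd x A A' : {subset ffv A' <= ffv A} ->
    (forall z, z \in fbv A' -> z \notin F) ->
    exists2 y, y \notin fvars A' &
      {subset [seq z <- ffv (fsubst y x A') | z != y] <= [seq z <- ffv A | z != x]} /\
      (forall z, z \in y :: fbv (fsubst y x A') -> z \notin F).
  move=> sA bA; have [y] := V_infinite (F ++ fvars A').
  rewrite mem_cat negb_or => /andP[yF yA]; exists y => //; split=> z.
    rewrite !mem_filter => /andP[zy] /(proj1 (fv_subst y x)).
    by rewrite inE (negPf zy) mem_filter => /andP[-> /sA].
  by rewrite inE (proj1 (bv_subst y x)) => /orP[/eqP->|/bA].
apply: syntax_ind => /=.
- by move=> P xs; exists (Atom xs); split=> //; apply: alpha_refl.
- by move=> x y; exists (Eq x y); split=> //; apply: alpha_refl.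
- by exists Bot; split=> //; apply: alpha_refl.
- move=> A [A' [aA sA bA]] B [B' [aB sB bB]].
  by exists (And A' B'); split; [apply: alpha_And|apply: sub2|apply: av2].
- move=> A [A' [aA sA bA]] B [B' [aB sB bB]].
  by exists (Or A' B'); split; [apply: alpha_Or|apply: sub2|apply: av2].
- move=> A [A' [aA sA bA]] B [B' [aB sB bB]].
  by exists (Imp A' B'); split; [apply: alpha_Imp|apply: sub2|apply: av2].
- move=> x A [A' [aA sA bA]]; have [y yA [sy by_]] := bnd x _ _ sA bA.
  exists (All y (fsubst y x A')); split=> //.
  by apply: alpha_trans (alpha_All x aA) (rename_All _ yA).
- move=> x A [A' [aA sA bA]]; have [y yA [sy by_]] := bnd x _ _ sA bA.
  exists (Ex y (fsubst y x A')); split=> //.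
  by apply: alpha_trans (alpha_Ex x aA) (rename_Ex _ yA).
- by move=> A [A' [aA sA bA]]; exists (Box A'); split=> //; apply: alpha_Box.
- by move=> A [A' [aA sA bA]]; exists (Dia A'); split=> //; apply: alpha_Dia.
- move=> x A [A' [aA sA bA]] t [t' [aT sT bT]].
  have [y yA [sy by_]] := bnd x _ _ sA bA.
  exists (Lam y (fsubst y x A') t'); split; [|exact: sub2|exact: (@av2 (y :: _))].
  by apply: alpha_trans (alpha_Lam x aA aT) (rename_Lam _ _ yA).
- by move=> x; exists (Var x); split=> //; apply: alphat_refl.
- move=> x A [A' [aA sA bA]]; have [y yA [sy by_]] := bnd x _ _ sA bA.
  exists (Iota y (fsubst y x A')); split=> //.
  by apply: alphat_trans (alphat_Iota x aA) (rename_Iota _ yA).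
Qed.

(** The measure for the truth lemma: instances of a scope are not subformulas of the quantified
    formula, but they have the size of the scope. *)
Fixpoint fsize A : nat :=
  match A with
  | Atom _ _ | Eq _ _ | Bot => 0
  | And A B | Or A B | Imp A B => (fsize A + fsize B).+1
  | All _ A | Ex _ A | Box A | Dia A => (fsize A).+1
  | Lam _ A t => (fsize A + tsize t).+1
  end
with tsize t : nat :=
  match t with
  | Var _ => 0
  | Iota _ A => (fsize A).+1
  end.

Lemma size_subst y x :
  (forall A, fsize (fsubst y x A) = fsize A) /\
  (forall t, tsize (tsubst y x t) = tsize t).
Proof.
by apply: syntax_ind => //= *; try case: ifP => _;
  repeat match goal with H : _ = _ |- _ => rewrite H end.
Qed.

End Substitution.

(** * Satisfaction under substitution and renaming *)

Section Semantics.
Variables (S : signature) (V : eqType) (M : model S).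
Implicit Types (s : V -> obj M) (A : form S V) (t : term S V).

Lemma upd_upd s x o o' : upd (upd s x o) x o' = upd s x o'.
Proof. by apply: functional_extensionality => z; rewrite /upd; case: eqP. Qed.

Lemma upd_comm s x y o o' : x <> y -> upd (upd s x o) y o' = upd (upd s y o') x o.
Proof.
move=> xy; apply: functional_extensionality => z; rewrite /upd.
by case: (z =P y) => // ->; case: (y =P x) => // yx; case: xy.
Qed.

Lemma iff_forall (T : Type) (P Q : T -> Prop) :
  (forall x, P x <-> Q x) -> (forall x, P x) <-> (forall x, Q x).
Proof. by move=> h; split=> H x; apply/h. Qed.

Lemma iff_ex2 (T : Type) (D P Q : T -> Prop) :
  (forall x, P x <-> Q x) -> (exists2 x, D x & P x) <-> (exists2 x, D x & Q x).
Proof. by move=> h; split=> -[x Dx /h]; exists x. Qed.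

Lemma sat_coincidence :
  (forall A s s' (w : world M), {in ffv A, s =1 s'} -> sat s w A <-> sat s' w A) /\
  (forall t s s' (w : world M) o,
     {in tfv t, s =1 s'} -> denotes s w t o <-> denotes s' w t o).
Proof.
have inl (s s' : V -> obj M) (l1 l2 : seq V) : {in l1 ++ l2, s =1 s'} -> {in l1, s =1 s'}.
  by move=> h z zl; apply: h; rewrite mem_cat zl.
have inr (s s' : V -> obj M) (l1 l2 : seq V) : {in l1 ++ l2, s =1 s'} -> {in l2, s =1 s'}.
  by move=> h z zl; apply: h; rewrite mem_cat zl orbT.
have bnd (s s' : V -> obj M) x l o : {in [seq z <- l | z != x], s =1 s'} ->
    {in l, upd s x o =1 upd s' x o}.
  move=> h z zl; rewrite /upd; case: (z =P x) => // /eqP zx.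
  by apply: h; rewrite mem_filter zx.
apply: syntax_ind => /=.
- move=> P xs s s' w h; have -> : map_tuple s xs = map_tuple s' xs => //.
  by apply: val_inj; apply/eq_in_map.
- by move=> x y s s' w h; rewrite !h // !inE eqxx ?orbT.
- by [].
- by move=> A IA B IB s s' w h; rewrite (IA _ _ _ (inl _ _ _ _ h)) (IB _ _ _ (inr _ _ _ _ h)).
- by move=> A IA B IB s s' w h; rewrite (IA _ _ _ (inl _ _ _ _ h)) (IB _ _ _ (inr _ _ _ _ h)).
- by move=> A IA B IB s s' w h; rewrite (IA _ _ _ (inl _ _ _ _ h)) (IB _ _ _ (inr _ _ _ _ h)).
- move=> x A IA s s' w h; apply: iff_forall => o.
  by rewrite (IA _ _ _ (bnd _ _ _ _ _ h)).
- move=> x A IA s s' w h; apply: iff_ex2 => o.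
  by rewrite (IA _ _ _ (bnd _ _ _ _ _ h)).
- by move=> A IA s s' w h; apply: iff_forall => v; rewrite (IA _ _ _ h).
- by move=> A IA s s' w h; apply: iff_ex2 => v; rewrite (IA _ _ _ h).
- move=> x A IA t IT s s' w h.
  by split=> -[o h1 h2]; exists o;
    rewrite ?(IA _ _ _ (bnd _ _ _ _ _ (inl _ _ _ _ h))) ?(IT _ _ _ _ (inr _ _ _ _ h)) //;
    rewrite -?(IA _ _ _ (bnd _ _ _ _ _ (inl _ _ _ _ h))) -?(IT _ _ _ _ (inr _ _ _ _ h)).
- by move=> x s s' w o h; rewrite h // inE.
- move=> x A IA s s' w o h; rewrite (IA _ _ _ (bnd _ _ _ _ _ h)).
  have -> // : (forall o', sat (upd s x o') w A -> o' = o) <->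
    (forall o', sat (upd s' x o') w A -> o' = o).
  by apply: iff_forall => o'; rewrite (IA _ _ _ (bnd _ _ _ _ _ h)).
Qed.

(** The proviso that [y] is not bound in [A] excludes capture, whether or not [x] occurs in the
    scope of a binder. *)
Lemma sat_subst y x :
  (forall A s (w : world M), y \notin fbv A ->
     sat s w (fsubst y x A) <-> sat (upd s x (s y)) w A) /\
  (forall t s (w : world M) o, y \notin tbv t ->
     denotes s w (tsubst y x t) o <-> denotes (upd s x (s y)) w t o).
Proof.
have bnd z A s (w : world M) o :
    (forall s (w : world M), y \notin fbv A ->
       sat s w (fsubst y x A) <-> sat (upd s x (s y)) w A) ->
    y \notin z :: fbv A ->
    sat (upd s z o) w (if z == x then A else fsubst y x A) <->
    sat (upd (upd s x (s y)) z o) w A.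
  move=> IH; rewrite inE negb_or => /andP[yz yA].
  case: (z =P x) => [->|zx]; first by rewrite upd_upd.
  have e : upd s z o y = s y by rewrite /upd (negPf yz).
  by rewrite IH // e upd_comm.
have vs s z : s (vsubst y x z) = upd s x (s y) z.
  by rewrite /vsubst /upd; case: eqP.
apply: syntax_ind => /=.
- move=> P xs s w _.
  have -> // : map_tuple s (map_tuple (vsubst y x) xs) = map_tuple (upd s x (s y)) xs.
  by apply: val_inj; rewrite /= -map_comp; apply: eq_map => z /=; rewrite vs.
- by move=> a b s w _; rewrite !vs.
- by [].
- by move=> A IA B IB s w; rewrite mem_cat negb_or => /andP[hA hB]; rewrite IA // IB.
- by move=> A IA B IB s w; rewrite mem_cat negb_or => /andP[hA hB]; rewrite IA // IB.
- by move=> A IA B IB s w; rewrite mem_cat negb_or => /andP[hA hB]; rewrite IA // IB.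
- by move=> z A IA s w h; apply: iff_forall => o; rewrite bnd.
- by move=> z A IA s w h; apply: iff_ex2 => o; rewrite bnd.
- by move=> A IA s w h; apply: iff_forall => v; rewrite IA.
- by move=> A IA s w h; apply: iff_ex2 => v; rewrite IA.
- move=> z A IA t IT s w; rewrite -cat_cons mem_cat negb_or => /andP[hA hT].
  split=> -[o h1 h2]; exists o;
    by [apply/(IT _ _ _ hT)|apply/(bnd _ _ _ _ _ IA)].
- by move=> z s w o _; rewrite vs.
- move=> z A IA s w o h; rewrite bnd //.
  have -> // : (forall o', sat (upd s z o') w (if z == x then A else fsubst y x A) -> o' = o) <->
    (forall o', sat (upd (upd s x (s y)) z o') w A -> o' = o).
  by apply: iff_forall => o'; rewrite bnd.
Qed.

Lemma sat_rename x y A s (w : world M) o : y \notin fvars A ->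
  sat (upd s y o) w (fsubst y x A) <-> sat (upd s x o) w A.
Proof.
rewrite mem_cat negb_or => /andP[yf yb].
have e : upd s y o y = o by rewrite /upd eqxx.
rewrite (proj1 (sat_subst y x)) // e.
apply: (proj1 sat_coincidence) => z zA; rewrite /upd; case: eqP => // _.
by case: eqP => // zy; rewrite zy (negPf yf) in zA.
Qed.

Lemma sat_alpha :
  (forall A A', alpha A A' -> forall s (w : world M), sat s w A <-> sat s w A') /\
  (forall t t', alphat t t' ->
     forall s (w : world M) o, denotes s w t o <-> denotes s w t' o).
Proof.
apply: alpha_mutind => //=.
- by move=> A B _ IH s w; rewrite IH.
- by move=> A B C _ I1 _ I2 s w; rewrite I1.
- by move=> A A' B B' _ IA _ IB s w; rewrite IA IB.
- by move=> A A' B B' _ IA _ IB s w; rewrite IA IB.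
- by move=> A A' B B' _ IA _ IB s w; rewrite IA IB.
- by move=> x A A' _ IA s w; apply: iff_forall => o; rewrite IA.
- by move=> x A A' _ IA s w; apply: iff_ex2 => o; rewrite IA.
- by move=> A A' _ IA s w; apply: iff_forall => o; rewrite IA.
- by move=> A A' _ IA s w; apply: iff_ex2 => o; rewrite IA.
- by move=> x A A' t t' _ IA _ IT s w; split=> -[o /IT h1 /IA h2]; exists o.
- by move=> x y A h s w; apply: iff_forall => o; rewrite sat_rename.
- by move=> x y A h s w; apply: iff_ex2 => o; rewrite sat_rename.
- by move=> x y A t h s w; apply: iff_ex2 => o; rewrite sat_rename.
- by move=> t t' _ IH s w o; rewrite IH.
- by move=> t1 t2 t3 _ I1 _ I2 s w o; rewrite I1.
- move=> x A A' _ IA s w o; rewrite IA.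
  have -> // : (forall o', sat (upd s x o') w A -> o' = o) <->
    (forall o', sat (upd s x o') w A' -> o' = o).
  by apply: iff_forall => o'; rewrite IA.
- move=> x y A h s w o; rewrite sat_rename //.
  have -> // : (forall o', sat (upd s x o') w A -> o' = o) <->
    (forall o', sat (upd s y o') w (fsubst y x A) -> o' = o).
  by apply: iff_forall => o'; rewrite sat_rename.
Qed.

(** The biconditional clause for descriptions splits into existence and uniqueness, so that results
    on [denotes] apply to denotation formulas. *)
Lemma sexpr_sat_Den (L : eqType) (fL : L -> world M) s t x w :
  sexpr_sat fL s (Den t x w) <-> denotes s (fL w) t (s x).
Proof.
case: t => [//|z A] /=; split=> [h|[h1 h2] o].
  by split=> [|o]; rewrite h.
by split=> [/h2|->].
Qed.

Lemma sexpr_sat_alpha (L : eqType) (fL : L -> world M) s (e e' : sexpr S V L) :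
  salpha e e' -> sexpr_sat fL s e <-> sexpr_sat fL s e'.
Proof.
case=> [w A A' h|t t' x w h]; first exact: (proj1 sat_alpha).
by rewrite !sexpr_sat_Den (proj2 sat_alpha _ _ h).
Qed.

End Semantics.

Lemma valid_alpha (S : signature) (V L : eqType) (N : nlrule -> Prop)
    (s s' : sequent S V L) :
  sequent_alpha s s' -> valid N s -> valid N s'.
Proof.
case: s s' => [G H] [G' H'] [/= aG aH] vs M MN fL fV hG'.
have hG e : List.In e G -> aexpr_sat fL fV e.
  elim: aG hG' e => //= e e' l l' ee _ IH h e0 [<-|]; last by apply: IH; eauto.
  have : aexpr_sat fL fV e' by apply: h; left.
  by case: ee => // a a' /(sexpr_sat_alpha fL fV) /= <-.
have [e] := vs M MN fL fV hG; rewrite /=.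
elim: aH => //= e1 e1' l l' ee _ IH [<-|eH] he.
  by exists e1'; [left|apply/(sexpr_sat_alpha fL fV ee)].
by have [e' ? ?] := IH eH he; exists e' => //; right.
Qed.

(** * Proof search *)

Section Search.
Variables (S : signature) (V L : eqType) (N : nlrule -> Prop) (B : seq V).
Hypotheses (V_infinite : infinite_type V) (L_infinite : infinite_type L).
Local Notation aexpr := (aexpr S V L).
Local Notation sexpr := (sexpr S V L).
Local Notation derivation := (derivation N).
Local Notation LL w A := (Inj (Lab w A)).
Local Notation LD t x w := (Inj (Den t x w)).

(** [IV] and [IW] record the variables and labels met so far. Rules such as [RefEq], [DenVar] or
    [RLam] choose a variable or label freely; the search offers them exactly the recorded ones. *)
Inductive item :=
| IL (e : aexpr)
| IR (e : sexpr)
| IV (x : V)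
| IW (w : L).

Implicit Types (G : seq aexpr) (D : seq sexpr) (H : seq item).
Local Notation left K w A := (K (IL (Inj (Lab w A)))).
Local Notation right K w A := (K (IR (Lab w A))).

(** Hintikka conditions: a branch follows one premise, hence the disjunctions. The value [False] for
    all other items forces them to stay in the sequent. *)
Definition resolved (a : item) (K : item -> Prop) : Prop :=
  match a with
  | IL (Inj (Lab w A)) =>
    match A with
    | And A B => left K w A /\ left K w B
    | Or A B => left K w A \/ left K w B
    | Imp A B => right K w A \/ left K w B
    | Ex x A => exists2 z, K (IL (Mem z w)) & left K w (fsubst z x A)
    | Dia A => exists2 u, K (IL (Rel w u)) & left K u A
    | Lam x A t => exists2 z, K (IL (LD t z w)) & left K w (fsubst z x A)
    | _ => False
    end
  | IR (Lab w A) =>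
    match A with
    | And A B => right K w A \/ right K w B
    | Or A B => right K w A /\ right K w B
    | Imp A B => left K w A /\ right K w B
    | All x A => exists2 z, K (IL (Mem z w)) & right K w (fsubst z x A)
    | Box A => exists2 u, K (IL (Rel w u)) & right K u A
    | _ => False
    end
  | IR (Den (Iota x A) y w) =>
    right K w (fsubst y x A) \/
    exists2 z, left K w (fsubst z x A) & right K w (Eq y z)
  | _ => False
  end.

(* The expressions that are principal in a rule whose premises drop them. *)
Definition transient (a : item) : bool :=
  match a with
  | IL (Inj (Lab _ (And _ _ | Or _ _ | Imp _ _ | Ex _ _ | Dia _ | Lam _ _ _)))
  | IR (Lab _ (And _ _ | Or _ _ | Imp _ _ | All _ _ | Box _))
  | IR (Den (Iota _ _) _ _) => true
  | _ => false
  end.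

Definition replace_at n (i : 'I_n) (z : V) (xs : n.-tuple V) : n.-tuple V :=
  [tuple if j == i then z else tnth xs j | j < n].

Definition req_Mem (x : V) (w : L) (b : item) (K : item -> Prop) : Prop :=
  match b with
  | IL (Inj (Lab v (All y A))) => v = w -> left K w (fsubst x y A)
  | IR (Lab v (Ex y A)) => v = w -> right K w (fsubst x y A)
  | IL (Rel v u) =>
      (N Incr -> v = w -> K (IL (Mem x u))) /\
      (N Decr -> u = w -> K (IL (Mem x v)))
  | _ => True
  end.

(* Here and in [req_Eq] the inequality excludes that the two principal
   expressions coincide: a sequent containing a single copy is not the
   conclusion of the rule. *)
Definition req_Rel (w v : L) (b : item) (K : item -> Prop) : Prop :=
  match b with
  | IL (Inj (Lab u (Box A))) => u = w -> left K v A
  | IR (Lab u (Dia A)) => u = w -> right K v A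
  | IL (Rel u u') =>
      (w, v) <> (u, u') ->
      (N Trans -> u = v -> K (IL (Rel w u'))) /\
      (N Eucl -> u = w -> K (IL (Rel v u')))
  | IW _ => N Eucl -> K (IL (Rel v v))
  | _ => True
  end.

(** In an identity only the first argument is replaced: this is the Euclidean property, and with
    reflexivity it yields symmetry and transitivity. *)
Definition req_Eq (w : L) (y z : V) (b : item) (K : item -> Prop) : Prop :=
  match b with
  | IW v => left K v (Eq y z)
  | IL (Inj (Lab v (Eq x a))) => v = w -> x = y -> a <> z -> left K w (Eq z a)
  | IL (Inj (Lab v (Atom P xs))) =>
      v = w -> forall i, tnth xs i = y -> left K w (Atom (replace_at i z xs))
  | IL (Inj (Den (Var a) x v)) =>
      v = w -> x = y -> K (IL (LD (Var a) z w))
  | _ => True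
  end.

(** [IW _] is a dummy partner for rules with one principal expression and no free choice of
    variable; the label of the expression itself can always serve. *)
Definition req_Den (t : term S V) (x : V) (w : L) (b : item) (K : item -> Prop) : Prop :=
  match t, b with
  | Iota y A, IV z => right K w (fsubst z y A) \/ left K w (Eq x z)
  | Iota y A, IW _ => left K w (fsubst x y A)
  | Var y, IW _ => left K w (Eq y x)
  | _, _ => True
  end.

Definition req_Lam (w : L) (x : V) (A : form S V) (t : term S V) (b : item)
    (K : item -> Prop) : Prop :=
  match b with
  | IV y => K (IR (Den t y w)) \/ right K w (fsubst y x A)
  | _ => True
  end.

Definition req_IW (w : L) (b : item) (K : item -> Prop) : Prop :=
  match b with
  | IV x => [/\ left K w (Eq x x), K (IL (LD (Var x) x w))
              & (N Cons -> K (IL (Mem x w)))]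
  | IW _ => (N RefW -> K (IL (Rel w w))) /\
            (N Ser -> exists u, K (IL (Rel w u)))
  | _ => True
  end.

(* What a fair search has to achieve for two items that have occurred. *)
Definition req (a b : item) (K : item -> Prop) : Prop :=
  (transient a -> resolved a K) /\
  match a with
  | IL (Mem x w) => req_Mem x w b K
  | IL (Rel w v) => req_Rel w v b K
  | IL (Inj (Lab w (Eq y z))) => req_Eq w y z b K
  | IL (Inj (Den t x w)) => req_Den t x w b K
  | IR (Lab w (Lam x A t)) => req_Lam w x A t b K
  | IW w => req_IW w b K
  | _ => True
  end.

(** * Clean items, histories and tasks *)

Definition item_fv (a : item) : seq V :=
  match a with IL e => aexpr_fv e | IR e => sexpr_fv e | IV x => [:: x] | IW _ => [::] end.
Definition item_bv (a : item) : seq V :=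
  match a with IL e => aexpr_bv e | IR e => sexpr_bv e | _ => [::] end.
Definition item_labels (a : item) : seq L :=
  match a with IL e => aexpr_labels e | IR e => sexpr_labels e | IV _ => [::] | IW w => [:: w] end.

Definition clean (a : item) : Prop :=
  (forall x, x \in item_fv a -> x \notin B) /\ {subset item_bv a <= B}.

Definition mono (Q : (item -> Prop) -> Prop) : Prop :=
  forall K K' : item -> Prop, (forall a, K a -> K' a) -> Q K -> Q K'.

Definition sub (G : seq aexpr) (D : seq sexpr) (K : item -> Prop) : Prop :=
  (forall e, List.In e G -> K (IL e)) /\ (forall e, List.In e D -> K (IR e)).

Definition live (G : seq aexpr) (D : seq sexpr) (a : item) : Prop :=
  match a with IL e => List.In e G | IR e => List.In e D | _ => True end.

(* H lists everything that has occurred so far on a branch whose last sequent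
   is G => D. *)
Record history (H : seq item) (G : seq aexpr) (D : seq sexpr) : Prop := History {
  hist_underivable : ~ derivation (G, D);
  hist_sub : sub G D (fun a => List.In a H);
  hist_clean : forall a, List.In a H -> clean a;
  hist_fv : forall a x, List.In a H -> x \in item_fv a -> List.In (IV x) H;
  hist_labels : forall a w, List.In a H -> w \in item_labels a -> List.In (IW w) H;
  hist_live : forall a, List.In a H -> live G D a \/ resolved a (fun a => List.In a H) }.

Definition good H := exists G D, history H G D.

(** Density as in forcing, for good lists ordered by inclusion. Together with [mono] it allows
    finitely many requirements to be met in succession, none being lost later. *)
Definition dense (H0 : seq item) (Q : (item -> Prop) -> Prop) : Prop :=
  forall H, good H -> List.incl H0 H ->
  exists H', [/\ good H', List.incl H H' & Q (fun a => List.In a H')].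

Definition task H0 Q := mono Q /\ dense H0 Q.

Lemma In_mem (T : eqType) (x : T) s : x \in s <-> List.In x s.
Proof.
elim: s => //= y s IH; rewrite inE -IH; split.
  by case/orP=> [/eqP->|]; [left|right].
by case=> [->|->]; rewrite ?eqxx ?orbT.
Qed.

Lemma resolved_mono a : mono (resolved a).
Proof.
move=> K K' h.
case: a => [[[w [? ?|? ?||? ?|? ?|? ?|? ?|? ?|?|?|? ? ?]|t x w]|x w|w v]
  |[w [? ?|? ?||? ?|? ?|? ?|? ?|? ?|?|?|? ? ?]|[y|y A] x w]|x|w] //=.
all: try (by case=> ?; [left|right]; apply: h).
all: try (by case=> ? ?; split; apply: h).
all: try (by case=> u ? ?; exists u; apply: h).
case=> [?|[u ? ?]]; first by left; apply: h.
by right; exists u; apply: h.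
Qed.

Lemma task_True H0 : task H0 (fun=> True).
Proof. by split=> // H gH _; exists H; split. Qed.

Lemma task_and H0 Q Q' : task H0 Q -> task H0 Q' -> task H0 (fun K => Q K /\ Q' K).
Proof.
move=> [mQ dQ] [mQ' dQ']; split; first by move=> K K' h [q q']; split; eauto.
move=> H gH s0; have [H1 [g1 s1 q1]] := dQ H gH s0.
have [H2 [g2 s2 q2]] := dQ' H1 g1 (List.incl_tran s0 s1).
exists H2; split=> //; first exact: List.incl_tran s2.
by split=> //; apply: mQ q1.
Qed.

Lemma task_imp H0 (P : Prop) Q : (P -> task H0 Q) -> task H0 (fun K => P -> Q K).
Proof.
move=> h; split; first by move=> K K' s q p; apply: (proj1 (h p)) (q p).
move=> H gH s0; case: (classic P) => [p|np]; last by exists H; split.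
by have [H' [? ? ?]] := proj2 (h p) H gH s0; exists H'.
Qed.

Lemma task_forall_in H0 (T : Type) (s : seq T) Q :
  (forall x, List.In x s -> task H0 (Q x)) ->
  task H0 (fun K => forall x, List.In x s -> Q x K).
Proof.
elim: s => [|x s IH] h; first by split=> // H gH _; exists H; split.
have [m d] := task_and (h x (or_introl erefl)) (IH (fun y ys => h y (or_intror ys))).
split=> [K K' sK q|H gH s0].
  have [q1 q2] := m K K' sK (conj (q x (or_introl erefl)) (fun y ys => q y (or_intror ys))).
  by move=> y /= [<-|/q2].
have [H' [g' s' [q1 q2]]] := d H gH s0.
by exists H'; split=> // y /= [<-|/q2].
Qed.

Lemma task_eq H0 Q Q' : (forall K, Q K <-> Q' K) -> task H0 Q -> task H0 Q'.
Proof.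
move=> h [m d]; split=> [K K' s /h q|H gH s]; first by apply/h/(m K).
by have [H' [? ? /h ?]] := d H gH s; exists H'.
Qed.

Lemma pure_clean G D :
  (forall e, List.In e G -> clean (IL e)) -> (forall e, List.In e D -> clean (IR e)) ->
  pure (G, D).
Proof.
move=> cG cD x; rewrite /sequent_fv /sequent_bv /= !mem_cat => hx.
have xB : x \notin B.
  case/orP: hx => /flattenP[l /In_mem /List.in_map_iff[e [<- he]]] xl.
    exact: (proj1 (cG e he)).
  exact: (proj1 (cD e he)).
apply/negP => /orP[] /flattenP[l /In_mem /List.in_map_iff[e [<- he]]] xl.
  by rewrite (proj2 (cG e he)) in xB.
by rewrite (proj2 (cD e he)) in xB.
Qed.

Definition items G D : seq item :=
  List.map IL G ++ List.map IR D ++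
  List.map IV (sequent_fv (G, D)) ++ List.map IW (sequent_labels (G, D)).

Lemma In_items G D a : List.In a (items G D) <->
  match a with
  | IL e => List.In e G
  | IR e => List.In e D
  | IV x => x \in sequent_fv (G, D)
  | IW w => w \in sequent_labels (G, D)
  end.
Proof.
rewrite /items !List.in_app_iff !List.in_map_iff.
by case: a => [e|e|x|w]; split;
  try (by case=> [|[|[|]]] [] ? [] // [->] // /In_mem);
  try (by move=> ?; left; eauto);
  try (by move=> ?; right; left; eauto);
  try (by move=> /In_mem ?; right; right; left; eauto);
  try (by move=> /In_mem ?; right; right; right; eauto).
Qed.

Lemma sequent_fvP G D x : x \in sequent_fv (G, D) <->
  (exists2 e, List.In e G & x \in aexpr_fv e) \/ (exists2 e, List.In e D & x \in sexpr_fv e).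
Proof.
rewrite /sequent_fv /= mem_cat; split.
  by case/orP=> /flattenP[l /In_mem /List.in_map_iff[e [<- he]]] xl; [left|right]; exists e.
by case=> -[e he xe]; apply/orP; [left|right]; apply/flattenP;
  eexists; eauto; apply/In_mem/List.in_map.
Qed.

Lemma sequent_labelsP G D w : w \in sequent_labels (G, D) <->
  (exists2 e, List.In e G & w \in aexpr_labels e) \/
  (exists2 e, List.In e D & w \in sexpr_labels e).
Proof.
rewrite /sequent_labels /= mem_cat; split.
  by case/orP=> /flattenP[l /In_mem /List.in_map_iff[e [<- he]]] xl; [left|right]; exists e.
by case=> -[e he xe]; apply/orP; [left|right]; apply/flattenP;
  eexists; eauto; apply/In_mem/List.in_map.
Qed.

Lemma history_items H G D : ~ derivation (G, D) ->
  (forall e, List.In e G -> clean (IL e)) -> (forall e, List.In e D -> clean (IR e)) ->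
  (forall a, List.In a H -> clean a) ->
  (forall a x, List.In a H -> x \in item_fv a -> List.In (IV x) H) ->
  (forall a w, List.In a H -> w \in item_labels a -> List.In (IW w) H) ->
  (forall a, List.In a H -> live G D a \/
     forall K, (forall a, List.In a H -> K a) -> sub G D K -> resolved a K) ->
  history (items G D ++ H) G D.
Proof.
move=> nd cG cD cH fH lH rH.
have sK a : List.In a H -> List.In a (items G D ++ H) by move=> ?; apply/List.in_app_iff; right.
have iK a : List.In a (items G D) -> List.In a (items G D ++ H).
  by move=> ?; apply/List.in_app_iff; left.
have subG : sub G D (fun a => List.In a (items G D ++ H)) by split=> e he; apply/iK/In_items.
split=> //.
- move=> a /List.in_app_iff[/In_items|/cH//].
  case: a => [e /cG//|e /cD//|x /sequent_fvP h|w _]; last by split.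
  split=> // y; rewrite inE => /eqP->.
  by case: h => [[e /cG[h _] /h]|[e /cD[h _] /h]].
- move=> a x /List.in_app_iff[/In_items h|h] xa; last by apply: sK; apply: fH h xa.
  apply/iK/In_items; case: a h xa => [e he xe|e he xe|y h|w h] //=.
  + by apply/sequent_fvP; left; exists e.
  + by apply/sequent_fvP; right; exists e.
  + by rewrite inE => /eqP->.
- move=> a w /List.in_app_iff[/In_items h|h] wa; last by apply: sK; apply: lH h wa.
  apply/iK/In_items; case: a h wa => [e he xe|e he xe|y h|v h] //=.
  + by apply/sequent_labelsP; left; exists e.
  + by apply/sequent_labelsP; right; exists e.
  + by rewrite inE => /eqP->.
- move=> a /List.in_app_iff[/In_items|/rH[|r]]; [by case: a => /=; auto|by left|right].
  exact: r.
Qed.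

(** * Rule steps on histories *)

Lemma In_perm (T : Type) (x : T) s : List.In x s -> exists s', Permutation (x :: s') s.
Proof.
move=> h; have [l1 [l2 ->]] := List.in_split _ _ h; exists (l1 ++ l2).
exact: Permutation_middle.
Qed.

(** Without repetitions in [s1], inclusion of sets gives inclusion of multisets. This is where
    coinciding principal expressions must be excluded. *)
Lemma incl_perm (T : Type) (s1 s2 : seq T) :
  List.NoDup s1 -> List.incl s1 s2 -> exists s, Permutation (s1 ++ s) s2.
Proof.
elim: s1 s2 => [|x s1 IH] s2 nd s12; first by exists s2.
have [xs1 nd1] : ~ List.In x s1 /\ List.NoDup s1 by inversion nd.
have [s2' P] := In_perm (s12 x (or_introl erefl)).
have [|s Q] := IH s2' nd1; last first.
  by exists s; apply: Permutation_trans P; apply: perm_skip.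
move=> y ys; case: (Permutation_in _ (Permutation_sym P) (s12 y (or_intror ys))) => // e.
by case: xs1; rewrite e.
Qed.

(* G' and D' contain what the premise p adds to the conclusion; p may also drop
   expressions of the conclusion, provided that it resolves them. *)
Lemma advance H G D Gc Dc ps Q : history H G D ->
  Permutation Gc G -> Permutation Dc D -> rule N ps (Gc, Dc) ->
  List.Forall (fun p : sequent S V L => exists G' D',
    [/\ List.Forall (fun e => clean (IL e)) G' /\ List.Forall (fun e => clean (IR e)) D',
        List.incl p.1 (G' ++ Gc) /\ List.incl p.2 (D' ++ Dc),
        forall e, List.In e Gc -> List.In e p.1 \/ forall K, sub p.1 p.2 K -> resolved (IL e) K,
        forall e, List.In e Dc -> List.In e p.2 \/ forall K, sub p.1 p.2 K -> resolved (IR e) K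
      & forall K : item -> Prop, sub p.1 p.2 K -> Q K]) ps ->
  exists H', [/\ good H', List.incl H H' & Q (fun a => List.In a H')].
Proof.
move=> hH PG PD r /List.Forall_forall h.
have cG e : List.In e G -> clean (IL e).
  by move=> /(proj1 (hist_sub hH)) /(hist_clean hH).
have cD e : List.In e D -> clean (IR e).
  by move=> /(proj2 (hist_sub hH)) /(hist_clean hH).
(* Otherwise all premises are derivable and the rule derives [(G, D)], which is pure because its
   members are clean. *)
have [p [pps np]] : exists p, List.In p ps /\ ~ derivation p.
  apply: NNPP => nex; apply: (hist_underivable hH).
  apply: derivation_step PG PD (pure_clean cG cD) r _ => p pps.
  by apply: NNPP => np; apply: nex; exists p.
have [G' [D' [[/List.Forall_forall cG' /List.Forall_forall cD'] [iG iD] kG kD q]]] := h p pps.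
case: p {h pps} np iG iD kG kD q => [G1 D1] /= np iG iD kG kD q.
exists (items G1 D1 ++ H); split.
- exists G1, D1; apply: history_items np _ _ (hist_clean hH) (hist_fv hH) (hist_labels hH) _.
  + by move=> e /iG /List.in_app_iff[/cG'//|/(Permutation_in _ PG)/cG].
  + by move=> e /iD /List.in_app_iff[/cD'//|/(Permutation_in _ PD)/cD].
  + move=> a /(hist_live hH)[|ra]; last by right=> K sK _; apply: resolved_mono sK ra.
    case: a => [e|e|x|w] /=; auto.
      by move=> /(Permutation_in _ (Permutation_sym PG))/kG[|ra]; [left|right=> K _; apply: ra].
    by move=> /(Permutation_in _ (Permutation_sym PD))/kD[|ra]; [left|right=> K _; apply: ra].
- by move=> a aH; apply/List.in_app_iff; right.
- by apply: q; split=> e he; apply/List.in_app_iff; left; apply/In_items.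
Qed.

Definition extend G D (a : sequent S V L) : sequent S V L := (a.1 ++ G, a.2 ++ D).

Definition cleans (a : sequent S V L) : Prop :=
  List.Forall (fun e => clean (IL e)) a.1 /\ List.Forall (fun e => clean (IR e)) a.2.

Lemma sub_extend G D a K : sub (extend G D a).1 (extend G D a).2 K -> sub a.1 a.2 K.
Proof. by case=> h1 h2; split=> e he; [apply: h1|apply: h2]; apply/List.in_app_iff; left. Qed.

(** [adds] lists, premise by premise, what takes the place of the principal expression. *)
Lemma consume_left H G D e G0 adds : history H G D -> Permutation (e :: G0) G ->
  rule N (List.map (extend G0 D) adds) (e :: G0, D) ->
  List.Forall (fun a => cleans a /\ forall K, sub a.1 a.2 K -> resolved (IL e) K) adds ->
  exists H', [/\ good H', List.incl H H' & resolved (IL e) (fun a => List.In a H')].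
Proof.
move=> hH PG r h; apply: (advance hH PG (Permutation_refl D) r).
apply/List.Forall_map; apply: List.Forall_impl h => a [ca ra]; exists a.1, a.2; split=> //.
- by split=> /= e' /List.in_app_iff[] he; apply/List.in_app_iff; [left|right; right|left|right].
- move=> e' [<-|he]; last by left; apply/List.in_app_iff; right.
  by right=> K /sub_extend/ra.
- by move=> e' he; left; apply/List.in_app_iff; right.
- by move=> K /sub_extend/ra.
Qed.

Lemma consume_right H G D e D0 adds : history H G D -> Permutation (e :: D0) D ->
  rule N (List.map (extend G D0) adds) (G, e :: D0) ->
  List.Forall (fun a => cleans a /\ forall K, sub a.1 a.2 K -> resolved (IR e) K) adds ->
  exists H', [/\ good H', List.incl H H' & resolved (IR e) (fun a => List.In a H')].
Proof.
move=> hH PD r h; apply: (advance hH (Permutation_refl G) PD r).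
apply/List.Forall_map; apply: List.Forall_impl h => a [ca ra]; exists a.1, a.2; split=> //.
- by split=> /= e' /List.in_app_iff[] he; apply/List.in_app_iff; [left|right|left|right; right].
- by move=> e' he; left; apply/List.in_app_iff; right.
- move=> e' [<-|he]; last by left; apply/List.in_app_iff; right.
  by right=> K /sub_extend/ra.
- by move=> K /sub_extend/ra.
Qed.

(* Premises are compared as sets: the calculus adds some expressions behind the
   principal one. *)
Lemma keep H G D Gc Dc ps adds Q : history H G D ->
  Permutation Gc G -> Permutation Dc D -> rule N ps (Gc, Dc) ->
  List.Forall2 (fun p a => [/\ cleans a,
    forall e, List.In e p.1 <-> List.In e (a.1 ++ Gc),
    forall e, List.In e p.2 <-> List.In e (a.2 ++ Dc)
    & forall K, sub a.1 a.2 K -> Q K]) ps adds ->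
  exists H', [/\ good H', List.incl H H' & Q (fun a => List.In a H')].
Proof.
move=> hH PG PD r h; apply: (advance hH PG PD r).
elim: h => // p a ps' adds' [ca e1 e2 q] _ IH; constructor=> //.
exists a.1, a.2; split=> //.
- by split=> e; [move/e1|move/e2].
- by move=> e he; left; apply/e1/List.in_app_iff; right.
- by move=> e he; left; apply/e2/List.in_app_iff; right.
- move=> K [k1 k2]; apply: q; split=> e he; [apply/k1/e1|apply/k2/e2];
  by apply/List.in_app_iff; left.
Qed.

Lemma clean_cat (f f' b b' : seq V) :
  (forall x, x \in f ++ f' -> x \notin B) /\ {subset b ++ b' <= B} ->
  ((forall x, x \in f -> x \notin B) /\ {subset b <= B}) /\
  ((forall x, x \in f' -> x \notin B) /\ {subset b' <= B}).
Proof.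
by case=> hf hb; split; split=> x hx; (apply: hf || apply: hb); rewrite mem_cat hx ?orbT.
Qed.

Lemma clean_subst (A : form S V) x y :
  (forall z, z \in [seq z <- ffv A | z != x] -> z \notin B) /\ {subset x :: fbv A <= B} ->
  y \notin B ->
  (forall z, z \in ffv (fsubst y x A) -> z \notin B) /\ {subset fbv (fsubst y x A) <= B}.
Proof.
case=> hf hb yB; split=> z.
  by move/(proj1 (fv_subst S y x)); rewrite inE => /orP[/eqP->|/hf].
by rewrite (proj1 (bv_subst S y x)) => zA; apply: hb; rewrite inE zA orbT.
Qed.

Lemma clean_Eq w x y : x \notin B -> y \notin B -> clean (IL (LL w (Eq x y))).
Proof. by move=> hx hy; split=> // z; rewrite !inE => /orP[]/eqP->. Qed.

Lemma clean_Mem x w : x \notin B -> clean (IL (Mem x w)).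
Proof. by move=> hx; split=> // z; rewrite !inE => /eqP->. Qed.

Lemma clean_Rel w v : clean (IL (Rel w v)).
Proof. by split. Qed.

Lemma clean_Den t x w : clean (IL (LD t x w)) <->
  x \notin B /\ ((forall x, x \in tfv t -> x \notin B) /\ {subset tbv t <= B}).
Proof.
split=> [[h1 h2]|[h1 [h2 h3]]]; split=> //; first by apply: h1; rewrite inE eqxx.
  by split=> // z zt; apply: h1; rewrite inE zt orbT.
by move=> z; rewrite inE => /orP[/eqP->|/h2].
Qed.

Lemma clean_Lam w x A t : clean (IL (LL w (Lam x A t))) ->
  ((forall z, z \in [seq z <- ffv A | z != x] -> z \notin B) /\ {subset x :: fbv A <= B}) /\
  ((forall x, x \in tfv t -> x \notin B) /\ {subset tbv t <= B}).
Proof. by move=> h; apply: clean_cat; rewrite cat_cons. Qed.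

Lemma fresh_var_ex G D : exists2 z, fresh_var z (G, D) & z \notin B.
Proof.
have [z] := V_infinite ((sequent_fv (G, D) ++ sequent_bv (G, D)) ++ B).
by rewrite mem_cat negb_or => /andP[? ?]; exists z.
Qed.

Lemma fresh_label_ex G D : exists u, fresh_label u (G, D).
Proof. exact: L_infinite. Qed.

Ltac split_adds :=
  repeat match goal with
  | |- List.Forall _ _ => constructor
  | |- List.Forall2 _ _ _ => constructor
  | |- cleans _ => split
  | |- cleans _ /\ _ => split
  | |- [/\ cleans _, _, _ & _] => split
  end;
  try assumption.

Ltac in_list := match goal with k : forall e, List.In e _ -> _ |- _ => apply: k; simpl; tauto end.
Ltac subs := move=> ? [? ?]; simpl.

Lemma task_resolved H0 a : List.In a H0 -> transient a -> task H0 (resolved a).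
Proof.
move=> aH0 ta; split; first exact: resolved_mono.
move=> H [G [D hH]] sH; have aH := sH _ aH0.
have ca := hist_clean hH aH.
(* If [a] has already been decomposed, nothing is left to do; otherwise it is still in the sequent
   and its rule applies. *)
case: (hist_live hH aH) => [|r]; last by exists H; split=> //; exists G, D.
case: a {aH aH0} ta ca => [[[w [? ?|? ?||A1 A2|A1 A2|A1 A2|x A|x A|A|A|x A t]|t x w]|x w|w v]
  |[w [? ?|? ?||A1 A2|A1 A2|A1 A2|x A|x A|A|A|x A t]|[y|y A] x w]|x|w] //= _ ca ha;
  match type of ha with
  | List.In _ G => have [G0 P] := In_perm ha
  | _ => have [D0 P] := In_perm ha
  end.
- have [c1 c2] := clean_cat ca.
  apply: (consume_left (adds := [:: ([:: LL w A1; LL w A2], [::])]) hH P (LAnd _ _ _ _ _ _)).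
  by split_adds; subs; split; in_list.
- have [c1 c2] := clean_cat ca.
  apply: (consume_left (adds := [:: ([:: LL w A1], [::]); ([:: LL w A2], [::])])
    hH P (LOr _ _ _ _ _ _)).
  by split_adds; subs; [left|right]; in_list.
- have [c1 c2] := clean_cat ca.
  apply: (consume_left (adds := [:: ([::], [:: Lab w A1]); ([:: LL w A2], [::])])
    hH P (LImp _ _ _ _ _ _)).
  by split_adds; subs; [left|right]; in_list.
(* Freshness refers to the current sequent only, not to [H]; avoiding [B] as well keeps the new
   items clean. *)
- have [z fz zB] := fresh_var_ex (LL w (Ex x A) :: G0) D.
  have c1 := clean_subst ca zB; have c2 := clean_Mem w zB.
  apply: (consume_left (adds := [:: ([:: Mem z w; LL w (fsubst z x A)], [::])]) hH P (LEx _ fz)).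
  by split_adds => K [? ?]; exists z; in_list.
- have [u fu] := fresh_label_ex (LL w (Dia A) :: G0) D.
  have c2 := clean_Rel w u.
  apply: (consume_left (adds := [:: ([:: Rel w u; LL u A], [::])]) hH P (LDia _ fu)).
  by split_adds => K [? ?]; exists u; in_list.
- have [z fz zB] := fresh_var_ex (LL w (Lam x A t) :: G0) D.
  have [c1 c2] := clean_Lam ca; have c3 := clean_subst c1 zB.
  have c4 : clean (IL (LD t z w)) by apply/clean_Den.
  apply: (consume_left (adds := [:: ([:: LD t z w; LL w (fsubst z x A)], [::])]) hH P (LLam _ fz)).
  by split_adds => K [? ?]; exists z; in_list.
- have [c1 c2] := clean_cat ca.
  apply: (consume_right (adds := [:: ([::], [:: Lab w A1]); ([::], [:: Lab w A2])])
    hH P (RAnd _ _ _ _ _ _)).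
  by split_adds; subs; [left|right]; in_list.
- have [c1 c2] := clean_cat ca.
  apply: (consume_right (adds := [:: ([::], [:: Lab w A1; Lab w A2])]) hH P (ROr _ _ _ _ _ _)).
  by split_adds; subs; split; in_list.
- have [c1 c2] := clean_cat ca.
  apply: (consume_right (adds := [:: ([:: LL w A1], [:: Lab w A2])]) hH P (RImp _ _ _ _ _ _)).
  by split_adds; subs; split; in_list.
- have [z fz zB] := fresh_var_ex G (Lab w (All x A) :: D0).
  have c1 := clean_subst ca zB; have c2 := clean_Mem w zB.
  apply: (consume_right (adds := [:: ([:: Mem z w], [:: Lab w (fsubst z x A)])]) hH P (RAll _ fz)).
  by split_adds => K [? ?]; exists z; in_list.
- have [u fu] := fresh_label_ex G (Lab w (Box A) :: D0).
  have c2 := clean_Rel w u.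
  apply: (consume_right (adds := [:: ([:: Rel w u], [:: Lab u A])]) hH P (RBox _ fu)).
  by split_adds => K [? ?]; exists u; in_list.
- have [z fz zB] := fresh_var_ex G (Den (Iota y A) x w :: D0).
  have [xB c1] := proj1 (clean_Den (Iota y A) x w) ca.
  have c2 := clean_subst c1 zB; have c3 := clean_subst c1 xB.
  have c4 := clean_Eq w xB zB.
  apply: (consume_right (adds := [:: ([::], [:: Lab w (fsubst x y A)]);
    ([:: LL w (fsubst z y A)], [:: Lab w (Eq x z)])]) hH P (RD _ fz)).
  split_adds => K [? ?]; first by left; in_list.
  by right; exists z; in_list.
Qed.

Lemma resolved_transient a K : resolved a K -> transient a.
Proof.
by case: a => [[[w [? ?|? ?||? ?|? ?|? ?|? ?|? ?|?|?|? ? ?]|t x w]|x w|w v]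
  |[w [? ?|? ?||? ?|? ?|? ?|? ?|? ?|?|?|? ? ?]|[y|y A] x w]|x|w].
Qed.

Lemma hist_persistent H G D a : history H G D -> List.In a H -> transient a = false ->
  live G D a.
Proof. by move=> hH /(hist_live hH)[//|/resolved_transient ->]. Qed.

(** * Tasks for the rules that keep their principal expressions *)

Section Requirements.
Variable H0 : seq item.
Hypothesis H0_clean : forall a, List.In a H0 -> clean a.

Lemma clean_IV x : List.In (IV x) H0 -> x \notin B.
Proof. by move=> /H0_clean[h _]; apply: h; rewrite inE. Qed.

(** The members of [pr] are never dropped, so they are still in the sequent at whatever stage the
    task is taken up. *)
Lemma task_left pr e : List.NoDup pr ->
  List.Forall (fun a => List.In (IL a) H0 /\ transient (IL a) = false) pr ->
  clean (IL e) ->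
  (forall G D, rule N [:: (e :: pr ++ G, D)] (pr ++ G, D)) ->
  task H0 (fun K => K (IL e)).
Proof.
move=> nd /List.Forall_forall hpr ce r; split; first by move=> K K'; apply.
move=> H [G [D hH]] sH.
have [|G0 P] := @incl_perm _ pr G nd.
  by move=> a /hpr[/sH aH ta]; apply: (hist_persistent hH aH ta).
apply: (keep (Q := fun K => K (IL e)) (adds := [:: ([:: e], [::])])
  hH P (Permutation_refl D) (r _ _)).
by split_adds => //; subs; in_list.
Qed.

Lemma task_right a s s' : List.In (IL a) H0 -> transient (IL a) = false ->
  List.In (IR s) H0 -> transient (IR s) = false -> clean (IR s') ->
  (forall G D, rule N [:: (a :: G, s :: s' :: D)] (a :: G, s :: D)) ->
  task H0 (fun K => K (IR s')).
Proof.
move=> aH ta sH ts ce r; split; first by move=> K K'; apply.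
move=> H [G [D hH]] subH.
have [G0 P] := In_perm (hist_persistent hH (subH _ aH) ta).
have [D0 Q] := In_perm (hist_persistent hH (subH _ sH) ts).
apply: (keep (Q := fun K => K (IR s')) (adds := [:: ([::], [:: s'])]) hH P Q (r _ _)).
by split_adds => //; first [by subs; in_list | by move=> ? /=; tauto].
Qed.

Lemma task_left0 e : clean (IL e) -> (forall G D, rule N [:: (e :: G, D)] (G, D)) ->
  task H0 (fun K => K (IL e)).
Proof. by move=> ce r; apply: (task_left (pr := [::]) _ _ ce r); constructor. Qed.

Lemma task_left1 a e : List.In (IL a) H0 -> transient (IL a) = false -> clean (IL e) ->
  (forall G D, rule N [:: (e :: a :: G, D)] (a :: G, D)) ->
  task H0 (fun K => K (IL e)).
Proof.
move=> aH ta ce r; apply: (task_left (pr := [:: a]) _ _ ce r); last by repeat constructor.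
by constructor=> //; constructor.
Qed.

Lemma task_left2 a b e : List.In (IL a) H0 -> List.In (IL b) H0 ->
  transient (IL a) = false -> transient (IL b) = false -> a <> b -> clean (IL e) ->
  (forall G D, rule N [:: (e :: a :: b :: G, D)] (a :: b :: G, D)) ->
  task H0 (fun K => K (IL e)).
Proof.
move=> aH bH ta tb ab ce r.
apply: (task_left (pr := [:: a; b]) _ _ ce r); last by repeat constructor.
constructor; first by case=> // ba; apply: ab.
by constructor=> //; constructor.
Qed.

Lemma task_Mem x w b : List.In (IL (Mem x w)) H0 -> List.In b H0 ->
  task H0 (req_Mem x w b).
Proof.
move=> aH; have xB : x \notin B by apply: (proj1 (H0_clean aH)); rewrite inE.
case: b => [[[v [? ?|? ?||? ?|? ?|? ?|y A|? ?|?|?|? ? ?]|? ? ?]|? ?|v u]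
  |[v [? ?|? ?||? ?|? ?|? ?|? ?|y A|?|?|? ? ?]|? ? ?]|?|?] bH /=; try exact: task_True.
- apply: task_imp => vw; subst v.
  have c := clean_subst (H0_clean bH) xB.
  apply: (task_left2 (a := Mem x w) (b := LL w (All y A))) => //.
  by move=> G D; apply: LAll.
- apply: task_and; apply: task_imp => n; apply: task_imp => e; subst.
    apply: (task_left2 (a := Mem x w) (b := Rel w u)) => //.
      exact: clean_Mem.
    by move=> G D; apply: rule_Incr.
  apply: (task_left2 (a := Mem x w) (b := Rel v w)) => //.
    exact: clean_Mem.
  by move=> G D; apply: rule_Decr.
- apply: task_imp => vw; subst v.
  have c := clean_subst (H0_clean bH) xB.
  apply: (task_right aH _ bH) => //.
  by move=> G D; apply: REx.
Qed.

Lemma task_Rel w v b : List.In (IL (Rel w v)) H0 -> List.In b H0 ->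
  task H0 (req_Rel w v b).
Proof.
move=> aH.
case: b => [[[u [? ?|? ?||? ?|? ?|? ?|? ?|? ?|A|?|? ? ?]|? ? ?]|? ?|u u']
  |[u [? ?|? ?||? ?|? ?|? ?|? ?|? ?|?|A|? ? ?]|? ? ?]|?|u] bH /=; try exact: task_True.
- apply: task_imp => e; subst u.
  apply: (task_left2 (a := Rel w v) (b := LL w (Box A))) => //.
    exact: (H0_clean bH).
  by move=> G D; apply: LBox.
- apply: task_imp => ne; apply: task_and; apply: task_imp => n; apply: task_imp => e; subst.
    apply: (task_left2 (a := Rel w v) (b := Rel v u')) => //; first by congruence.
    by move=> G D; apply: rule_Trans.
  apply: (task_left2 (a := Rel w v) (b := Rel w u')) => //; first by congruence.
  by move=> G D; apply: rule_Eucl.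
- apply: task_imp => e; subst u.
  apply: (task_right aH _ bH) => //; first exact: (H0_clean bH).
  by move=> G D; apply: RDia.
- apply: task_imp => n; apply: (task_left1 (a := Rel w v)) => //.
  by move=> G D; apply: rule_Euclc.
Qed.

Lemma vsubst_neq (y x z : V) : z != x -> vsubst y x z = z.
Proof. by rewrite /vsubst => /negPf->. Qed.

Lemma vsubst_eq (y x : V) : vsubst y x x = y.
Proof. by rewrite /vsubst eqxx. Qed.

Lemma task_Eq w y z b : List.In (IL (LL w (Eq y z))) H0 -> List.In b H0 ->
  task H0 (req_Eq w y z b).
Proof.
move=> aH; have [yB zB] : y \notin B /\ z \notin B.
  by split; apply: (proj1 (H0_clean aH)); rewrite !inE eqxx ?orbT.
case: b => [[[v [P xs|x a||? ?|? ?|? ?|? ?|? ?|?|?|? ? ?]|[a|? ?] x v]|? ?|? ?]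
  |[v [? ?|? ?||? ?|? ?|? ?|? ?|? ?|?|?|? ? ?]|? ? ?]|?|v] bH /=; try exact: task_True.
- apply: task_imp => e; subst v.
  (* The argument places form a finite list, which turns the requirement into finitely many
     tasks. *)
  apply: (task_eq (Q := fun K => forall i, List.In i (enum 'I_(arity P)) ->
    tnth xs i = y -> left K w (Atom (replace_at i z xs)))) => [K|].
    by split=> h i; [apply: h; apply/In_mem; rewrite mem_enum|move=> _; apply: h].
  apply: task_forall_in => i _; apply: task_imp => e.
  (* The fresh x marks the single occurrence on which Repl is to act. *)
  have [x] := V_infinite (y :: z :: xs); rewrite !inE !negb_or => /and3P[xy xz xxs].
  apply: (task_left2 (a := LL w (Atom xs)) (b := LL w (Eq y z))) => //.
  + split=> // u /mapP[j _ ->]; case: eqP => // _.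
    by apply: (proj1 (H0_clean bH)); apply: mem_tnth.
  + have sE u : tnth xs i = u \/ u = z ->
        aexpr_subst u x (LL w (Atom (replace_at i x xs))) = LL w (Atom (replace_at i u xs)).
      move=> _ /=; congr (LL w (Atom _)); apply: eq_from_tnth => j.
      rewrite tnth_map !tnth_mktuple; case: eqP => _; first exact: vsubst_eq.
      by apply: vsubst_neq; apply: contraNneq xxs => <-; apply: mem_tnth.
    have eq_xs : replace_at i y xs = xs.
      by apply: eq_from_tnth => j; rewrite tnth_mktuple; case: eqP => // ->.
    move=> G D; have := Repl N x y z G D (repl_Lab w (atomic_Atom (replace_at i x xs))).
    by rewrite !sE ?eq_xs; auto.
- apply: task_imp => e; apply: task_imp => e'; apply: task_imp => ne; subst.
  (* As [x] differs from [a], it marks the first argument alone, even if [a] is [y]. *)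
  have [x] := V_infinite [:: a]; rewrite !inE => xa.
  apply: (task_left2 (a := LL w (Eq y a)) (b := LL w (Eq y z))) => //.
  + by congruence.
  + by apply: clean_Eq => //; apply: (proj1 (H0_clean bH)); rewrite !inE eqxx orbT.
  + move=> G D; have := Repl N x y z G D (repl_Lab w (atomic_Eq S x a)).
    by rewrite /= !vsubst_eq !vsubst_neq // eq_sym.
- apply: task_imp => e; apply: task_imp => e'; subst.
  have [x] := V_infinite [:: a]; rewrite !inE => xa.
  apply: (task_left2 (a := LD (Var a) y w) (b := LL w (Eq y z))) => //.
  + apply/clean_Den; split=> //; split=> // u; rewrite inE => /eqP->.
    by apply: (proj1 (H0_clean bH)); rewrite !inE eqxx orbT.
  + move=> G D; have := Repl N x y z G D (repl_Den S w a x).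
    by rewrite /= !vsubst_eq !vsubst_neq // eq_sym.
- apply: (task_left1 (a := LL w (Eq y z))) => //.
    exact: clean_Eq.
  by move=> G D; apply: RigVar.
Qed.

Lemma task_Den t x w b : List.In (IL (LD t x w)) H0 -> List.In b H0 ->
  task H0 (req_Den t x w b).
Proof.
move=> aH; have [xB ct] := proj1 (clean_Den _ _ _) (H0_clean aH).
case: t aH ct => [y|y A] aH ct; case: b => [?|?|z|v] bH /=; try exact: task_True.
- apply: (task_left1 (a := LD (Var y) x w)) => //.
    by apply: clean_Eq => //; apply: (proj1 ct); rewrite inE.
  by move=> G D; apply: DenId.
- have zB := clean_IV bH.
  split; first by move=> K K' h [r|l]; [left|right]; apply: h.
  move=> H [G [D hH]] sH.
  have [G0 P] := In_perm (hist_persistent hH (sH _ aH) erefl).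
  have c1 := clean_subst ct zB; have c2 := clean_Eq w xB zB.
  apply: (keep (Q := fun K => right K w (fsubst z y A) \/ left K w (Eq x z))
    (adds := [:: ([::], [:: Lab w (fsubst z y A)]); ([:: LL w (Eq x z)], [::])])
    hH P (Permutation_refl D) (LD2 _ w y x z A G0 D)).
  by split_adds => //; subs; [left|right]; in_list.
- have c1 := clean_subst ct xB.
  apply: (task_left1 (a := LD (Iota y A) x w)) => //.
  by move=> G D; apply: LD1.
Qed.

Lemma task_Lam w x A t b : List.In (IR (Lab w (Lam x A t))) H0 -> List.In b H0 ->
  task H0 (req_Lam w x A t b).
Proof.
(* [clean] is the same on both sides up to conversion. *)
move=> aH; have [cA ct] := clean_Lam (H0_clean aH : clean (IL (LL w (Lam x A t)))).
case: b => [?|?|y|?] bH /=; try exact: task_True.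
have yB := clean_IV bH.
split; first by move=> K K' h [r|l]; [left|right]; apply: h.
move=> H [G [D hH]] sH.
have [D0 P] := In_perm (hist_persistent hH (sH _ aH) erefl).
have c1 := clean_subst cA yB.
have c2 : clean (IR (Den t y w)) by apply/(clean_Den t y w).
apply: (keep (Q := fun K => K (IR (Den t y w)) \/ right K w (fsubst y x A))
  (adds := [:: ([::], [:: Den t y w]); ([::], [:: Lab w (fsubst y x A)])])
  hH (Permutation_refl G) P (RLam _ w x y A t G D0)).
by split_adds => //; try (by move=> ? /=; tauto); subs; [left|right]; in_list.
Qed.

Lemma task_IW w b : List.In (IW w) H0 -> List.In b H0 -> task H0 (req_IW w b).
Proof.
move=> aH; case: b => [?|?|x|v] bH /=; try exact: task_True.
  have xB := clean_IV bH.
  apply: (task_eq (Q := fun K => left K w (Eq x x) /\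
    (K (IL (LD (Var x) x w)) /\ (N Cons -> K (IL (Mem x w)))))).
    by move=> K; split=> [[? [? ?]]|[? ? ?]].
  apply: task_and; last apply: task_and.
  - apply: task_left0 => //.
      exact: clean_Eq.
    by move=> G D; apply: RefEq.
  - apply: task_left0 => //.
      by apply/clean_Den; split=> //; split=> // u; rewrite inE => /eqP->.
    by move=> G D; apply: DenVar.
  - apply: task_imp => n; apply: task_left0 => //.
      exact: clean_Mem.
    by move=> G D; apply: rule_Cons.
apply: task_and; apply: task_imp => n.
  apply: task_left0 => //.
  by move=> G D; apply: rule_RefW.
split; first by move=> K K' h [u ku]; exists u; apply: h.
move=> H [G [D hH]] sH; have [u fu] := fresh_label_ex G D.
have c := clean_Rel w u.
apply: (keep (Q := fun K => exists u, K (IL (Rel w u))) (adds := [:: ([:: Rel w u], [::])])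
  hH (Permutation_refl G) (Permutation_refl D) (rule_Ser w n fu)).
by split_adds => //; subs; exists u; in_list.
Qed.

Lemma task_req a b : List.In a H0 -> List.In b H0 -> task H0 (req a b).
Proof.
move=> aH bH; apply: task_and; first by apply: task_imp; apply: task_resolved.
case: a aH => [[[w [? ?|? ?||? ?|? ?|? ?|? ?|? ?|?|?|? ? ?]|? ? ?]|? ?|? ?]
  |[w [? ?|? ?||? ?|? ?|? ?|? ?|? ?|?|?|? ? ?]|? ? ?]|?|?] aH /=; try exact: task_True.
- exact: task_Eq.
- exact: task_Den.
- exact: task_Mem.
- exact: task_Rel.
- exact: task_Lam.
- exact: task_IW.
Qed.

End Requirements.

(** * Stages of the search and their limit *)

Lemma saturate_step H : good H -> exists H', [/\ good H', List.incl H H' &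
  forall a, List.In a H -> forall b, List.In b H -> req a b (fun a => List.In a H')].
Proof.
move=> gH; have [G [D hH]] := gH.
have [_ d] : task H (fun K => forall a, List.In a H -> forall b, List.In b H -> req a b K).
  apply: task_forall_in => a aH; apply: task_forall_in => b bH.
  exact: task_req (hist_clean hH) _ _ _ _.
exact: d gH (List.incl_refl H).
Qed.

Lemma req_mono H a b : good H -> List.In a H -> List.In b H -> mono (req a b).
Proof. by case=> G [D hH] aH bH; apply: (proj1 (task_req (hist_clean hH) aH bH)). Qed.

(* K encodes both sides of the union of the sequents along an infinite branch. *)
Record saturated (K : item -> Prop) : Prop := Saturated {
  saturated_req : forall a b, K a -> K b -> req a b K;
  saturated_clean : forall a, K a -> clean a;
  saturated_fv : forall a x, K a -> x \in item_fv a -> K (IV x);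
  saturated_labels : forall a w, K a -> w \in item_labels a -> K (IW w);
  saturated_atomic : forall w p, atomic p -> left K w p -> right K w p -> False;
  saturated_Den : forall y x w, K (IL (LD (Var y) x w)) -> K (IR (Den (Var y) x w)) -> False;
  saturated_Bot : forall w, left K w Bot -> False }.

(** Any two items of the union meet at some stage; their requirement is satisfied at the next one
    and persists by monotonicity. *)
Lemma saturation H0 : good H0 ->
  exists2 K, saturated K & forall a, List.In a H0 -> K a.
Proof.
move=> gH0.
pose T := {H | good H}.
have next (H : T) : {H' : T | List.incl (sval H) (sval H') /\
    forall a, List.In a (sval H) -> forall b, List.In b (sval H) ->
      req a b (fun a => List.In a (sval H'))}.
  apply: constructive_indefinite_description.
  by have [H' [gH' ? ?]] := saturate_step (proj2_sig H); exists (exist _ H' gH').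
pose h n := iter n (fun H : T => sval (next H)) (exist _ H0 gH0 : T).
have hS n : List.incl (sval (h n)) (sval (h n.+1)) by case: (svalP (next (h n))).
have hle m n : m <= n -> List.incl (sval (h m)) (sval (h n)).
  elim: n => [|n IH]; first by rewrite leqn0 => /eqP->; apply: List.incl_refl.
  rewrite leq_eqVlt => /orP[/eqP->|]; first exact: List.incl_refl.
  by rewrite ltnS => /IH s; apply: List.incl_tran s (hS n).
pose K a := exists n, List.In a (sval (h n)).
have K2 a b : K a -> K b -> exists n, List.In a (sval (h n)) /\ List.In b (sval (h n)).
  move=> [m am] [n bn]; exists (maxn m n).
  by split; [apply: hle am|apply: hle bn]; rewrite ?leq_maxl ?leq_maxr.
have g n : exists G D, history (sval (h n)) G D := proj2_sig (h n).
exists K; last by move=> a aH; exists 0.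
(* Two persistent items lie together in one underivable sequent, so they cannot form an initial
   sequent. *)
have K_init a b : transient a = false -> transient b = false -> K a -> K b ->
    exists G D, [/\ ~ derivation (G, D), pure (G, D), live G D a & live G D b].
  move=> ta tb Ka Kb; have [n [an bn]] := K2 a b Ka Kb.
  have [G [D hH]] := g n; exists G, D; split.
  - exact: hist_underivable hH.
  - by apply: pure_clean => e he; apply: (hist_clean hH); case: (hist_sub hH); auto.
  - exact: hist_persistent hH an ta.
  - exact: hist_persistent hH bn tb.
split.
- move=> a b Ka Kb; have [n [an bn]] := K2 a b Ka Kb.
  have [_ r] := svalP (next (h n)).
  apply: (req_mono (proj2_sig (h n)) an bn) (r a an b bn) => c cn.
  by exists n.+1.
- by move=> a [n an]; have [G [D hH]] := g n; apply: hist_clean hH _ an.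
- by move=> a x [n an] xa; have [G [D hH]] := g n; exists n; apply: hist_fv hH _ _ an xa.
- by move=> a x [n an] xa; have [G [D hH]] := g n; exists n; apply: hist_labels hH _ _ an xa.
- move=> w p ap l r.
  have [||G [D [nd pu lG lD]]] := K_init _ _ _ _ l r; try by case: ap.
  have [G0 PG] := In_perm lG; have [D0 PD] := In_perm lD.
  by apply: nd; apply: derivation_step PG PD pu (init_atom _ _ _ _ ap) _.
- move=> y x w l r.
  have [||G [D [nd pu lG lD]]] := K_init _ _ _ _ l r => //.
  have [G0 PG] := In_perm lG; have [D0 PD] := In_perm lD.
  by apply: nd; apply: derivation_step PG PD pu (init_Den _ _ _ _ _ _) _.
- move=> w l.
  have [||G [D [nd pu lG _]]] := K_init _ _ _ _ l l => //.
  have [G0 PG] := In_perm lG.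
  by apply: nd; apply: derivation_step PG (Permutation_refl D) pu (init_Bot _ _ _ _) _.
Qed.

(** The sequent may have no free variable or no label; [x0] and [w0] ensure that some variable and
    some label occur. *)
Lemma good_initial G D x0 w0 : ~ derivation (G, D) ->
  (forall e, List.In e G -> clean (IL e)) -> (forall e, List.In e D -> clean (IR e)) ->
  x0 \notin B -> good (items G D ++ [:: IV x0; IW w0]).
Proof.
move=> nd cG cD xB; exists G, D; apply: history_items => //.
- by move=> a [<-|[<-|[]]]; split=> // x; rewrite inE => /eqP->.
- by move=> a x [<-|[<-|[]]] //; rewrite inE => /eqP->; left.
- by move=> a w [<-|[<-|[]]] //; rewrite inE => /eqP->; right; left.
- by move=> a [<-|[<-|[]]]; left.
Qed.

End Search.

(** * The canonical model *)

Section CanonicalModel.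
Variables (S : signature) (V L : eqType) (N : nlrule -> Prop) (B : seq V).
Local Notation item := (item S V L).
Variables (K : item -> Prop) (x0 : V) (w0 : L).
Hypotheses (K_sat : saturated N B K) (K_x0 : K (IV S L x0)) (K_w0 : K (IW S V w0)).
Local Notation IL := (@IL S V L).
Local Notation IR := (@IR S V L).
Local Notation IV := (@IV S V L).
Local Notation IW := (@IW S V L).
Local Notation LL w A := (Inj (Lab w A)).
Local Notation LD t x w := (Inj (Den t x w)).
Local Notation left w A := (K (IL (LL w A))).
Local Notation right w A := (K (IR (Lab w A))).
Implicit Types (A : form S V) (t : term S V) (x y z : V) (w v u : L).

(** * Equality of variables in the saturated set *)

Definition eqv y z : Prop := exists w, left w (Eq y z).

Lemma K_req a b : K a -> K b -> req N a b K.
Proof. exact: (saturated_req K_sat). Qed.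

Lemma K_resolved a : K a -> transient a -> resolved a K.
Proof. by move=> Ka; apply: (proj1 (K_req Ka Ka)). Qed.

Lemma K_label w a : K a -> w \in item_labels a -> K (IW w).
Proof. exact: (saturated_labels K_sat). Qed.

Lemma K_var x a : K a -> x \in item_fv a -> K (IV x).
Proof. exact: (saturated_fv K_sat). Qed.

Lemma K_left_label w A : left w A -> K (IW w).
Proof. by move/K_label; apply; rewrite inE. Qed.

Lemma K_right_label w A : right w A -> K (IW w).
Proof. by move/K_label; apply; rewrite inE. Qed.

(** [RigVar] copies equations to every occurring label, so the label in [eqv] is immaterial. *)
Lemma eqv_at w y z : K (IW w) -> eqv y z -> left w (Eq y z).
Proof. by move=> Kw [v h]; apply: (proj2 (K_req h Kw)). Qed.

Lemma eqv_var y z : eqv y z -> K (IV y) /\ K (IV z).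
Proof. by case=> w h; split; apply: K_var h _; rewrite !inE eqxx ?orbT. Qed.

Lemma Eq_refl w x : K (IW w) -> K (IV x) -> left w (Eq x x).
Proof. by move=> Kw Kx; case: (proj2 (K_req Kw Kx)). Qed.

Lemma eqv_refl x : K (IV x) -> eqv x x.
Proof. by exists w0; apply: Eq_refl. Qed.

Lemma eqv_euclid y z a : eqv y a -> eqv y z -> eqv z a.
Proof.
move=> ya yz; have [_ Kz] := eqv_var yz.
(* For [a = z] both hypotheses may be the same item, and replacement gives nothing; reflexivity
   does. *)
case: (classic (a = z)) => [->|ne]; first exact: eqv_refl.
exists w0; apply: (proj2 (K_req (eqv_at K_w0 yz) (eqv_at K_w0 ya))) => //.
Qed.

Lemma eqv_sym y z : eqv y z -> eqv z y.
Proof. by move=> yz; have [Ky _] := eqv_var yz; apply: eqv_euclid (eqv_refl Ky) yz. Qed.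

Lemma eqv_trans y z a : eqv y z -> eqv z a -> eqv y a.
Proof. by move=> /eqv_sym zy za; apply: eqv_euclid za zy. Qed.

(** [req_Eq] changes one place at a time, so the arguments are exchanged one by one: [mix k] has its
    first [k] entries from [xs], the others from [ys]. *)
Lemma Atom_eqv w (P : letter S) (xs ys : (arity P).-tuple V) :
  (forall i, eqv (tnth ys i) (tnth xs i)) -> left w (Atom ys) -> left w (Atom xs).
Proof.
move=> e hy; have Kw := K_left_label hy.
pose mix k := [tuple if i < k then tnth xs i else tnth ys i | i < arity P].
suff h k : k <= arity P -> left w (Atom (mix k)).
  have -> : xs = mix (arity P).
    by apply: eq_from_tnth => i; rewrite tnth_mktuple ltn_ord.
  exact: h.
elim: k => [_|k IH kP].
  by have -> // : mix 0 = ys by apply: eq_from_tnth => i; rewrite tnth_mktuple.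
pose i := Ordinal kP.
have ti : tnth (mix k) i = tnth ys i by rewrite tnth_mktuple ltnn.
have := proj2 (K_req (eqv_at Kw (e i)) (IH (ltnW kP))) erefl i ti.
congr (left w (Atom _)); apply: eq_from_tnth => j; rewrite !tnth_mktuple ltnS.
case: (j =P i) => [->|ji]; first by rewrite leqnn.
by rewrite [j <= k]leq_eqVlt; case: eqP => // jk; case: ji; apply: val_inj.
Qed.

(** * Objects, worlds and accessibility *)

Definition vclass : Type := {C : V -> Prop | exists2 y, K (IV y) & C = eqv y}.

(** An assignment is total on [V]; variables that never occur are sent to the class of [x0]. *)
Definition occurring y : V := if excluded_middle_informative (K (IV y)) then y else x0.

Lemma K_occurring y : K (IV (occurring y)).
Proof. by rewrite /occurring; case: excluded_middle_informative. Qed.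

Definition cls y : vclass :=
  exist _ (eqv (occurring y)) (ex_intro2 _ _ (occurring y) (K_occurring y) erefl).

Lemma occurring_id y : K (IV y) -> occurring y = y.
Proof. by rewrite /occurring; case: excluded_middle_informative. Qed.

Lemma cls_inj y z : K (IV y) -> K (IV z) -> cls y = cls z -> eqv y z.
Proof.
move=> Ky Kz [] /(f_equal (fun C => C z)); rewrite !occurring_id // => ->.
exact: eqv_refl.
Qed.

Lemma cls_eq y z : eqv y z -> cls y = cls z.
Proof.
move=> yz; have [Ky Kz] := eqv_var yz; apply: eq_sig_hprop => [C p q|/=].
  exact: proof_irrelevance.
rewrite !occurring_id //; apply: functional_extensionality => a.
apply: propositional_extensionality; split=> h.
  exact: eqv_trans (eqv_sym yz) h.
exact: eqv_trans yz h.
Qed.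

Lemma vclass_cls (o : vclass) : exists2 y, K (IV y) & o = cls y.
Proof.
case: o => C [y Ky e]; exists y => //; apply: eq_sig_hprop => [D p q|/=].
  exact: proof_irrelevance.
by rewrite occurring_id.
Qed.

Definition occurs_label (w : option L) : Prop := if w is Some a then K (IW a) else False.

(** Labels that never occur are worlds too. Like [None] they see only themselves, and by [can_dom]
    they have the full domain, so they violate none of the frame properties. *)
Definition can_acc (w v : option L) : Prop :=
  match w, v with
  | Some a, Some b => K (IL (Rel a b))
  | _, _ => False
  end \/ (w = v /\ ~ occurs_label w).

Definition can_dom (w : option L) (o : vclass) : Prop :=
  if w is Some a then K (IW a) -> exists2 y, K (IL (Mem y a)) & o = cls y else True.

(* The isolated world None, whose domain is full, makes every object belong to
   some domain. *)
Lemma can_cover (o : vclass) : exists w : option L, can_dom w o.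
Proof. by exists None. Qed.

Definition can_frame : frame :=
  Frame can_acc (inhabits None) (inhabits (cls x0)) can_cover.

Definition can_model : model S :=
  @Model S can_frame (fun P (w : option L) (os : (arity P).-tuple vclass) =>
    if w is Some a then exists2 ys, left a (Atom ys) & os = map_tuple cls ys else False).

Lemma can_accP w (v : option L) : K (IW w) -> can_acc (Some w) v ->
  exists2 u, v = Some u & K (IL (Rel w u)).
Proof. by move=> Kw [|[_ []]] //; case: v => // u; exists u. Qed.

Lemma Rel_labels w v : K (IL (Rel w v)) -> K (IW w) /\ K (IW v).
Proof. by move=> h; split; apply: K_label h _; rewrite !inE eqxx ?orbT. Qed.

Lemma can_frame_property n : N n -> frame_property can_frame n.
Proof.
have caseK (w : option L) : (exists2 a, w = Some a & K (IW a)) \/ ~ occurs_label w.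
  by case: w => [a|]; [case: (classic (K (IW a))); [left; exists a|right]|right].
have caseA (w v : option L) : can_acc w v ->
    (exists a b, [/\ w = Some a, v = Some b & K (IL (Rel a b))]) \/ w = v /\ ~ occurs_label w.
  by case; [case: w v => [a|] [b|] // h; left; exists a, b|right].
case: n => Nn /=.
- move=> w; case: (caseK w) => [[a -> Ka]|]; last by right.
  by left; apply: (proj1 (proj2 (K_req Ka Ka))).
- move=> w; case: (caseK w) => [[a -> Ka]|]; last by exists w; right.
  by have [u h] := proj2 (proj2 (K_req Ka Ka)) Nn; exists (Some u); left.
- move=> w v u /caseA[[a [b [-> -> ab]]]|[-> _] //].
  have [_ Kb] := Rel_labels ab => /(can_accP Kb)[c -> bc]; left.
  (* A coincidence forces [a], [b] and [c] to be equal, and the conclusion is the atom itself. *)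
  case: (classic ((a, b) = (b, c))) => [[? ?]|ne]; first by subst.
  by apply: (proj1 (proj2 (K_req ab bc) ne)).
- move=> w v u /caseA[[a [b [-> -> ab]]]|[-> _] //].
  have [Ka Kb] := Rel_labels ab => /(can_accP Ka)[c -> ac]; left.
  (* The coinciding case asks for [Rel b b], which is what Eucl^c provides. *)
  case: (classic ((a, b) = (a, c))) => [[<-]|ne].
    exact: (proj2 (K_req ab Kb) Nn).
  exact: (proj2 (proj2 (K_req ab ac) ne) Nn erefl).
- move=> w v /caseA[[a [b [-> -> ab]]]|[-> _] //] o h Kb.
  have [Ka _] := Rel_labels ab; have [y ya ->] := h Ka; exists y => //.
  exact: (proj1 (proj2 (K_req ya ab)) Nn erefl).
- move=> w v /caseA[[a [b [-> -> ab]]]|[-> _] //] o h Ka.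
  have [_ Kb] := Rel_labels ab; have [y yb ->] := h Kb; exists y => //.
  exact: (proj2 (proj2 (K_req yb ab)) Nn erefl).
(* The rule [Cons] puts every occurring variable into every occurring label, so all domains are
   full. *)
- have full (w : option L) o : can_dom w o.
    case: w => // a Ka; have [y Ky ->] := vclass_cls o; exists y => //.
    by have [_ _ h] := proj2 (K_req Ka Ky); apply: h.
  by move=> w v _ o; split=> _; apply: full.
Qed.

(** * Truth in the canonical model *)

Local Notation sat_at w A := (sat (M := can_model) cls (Some w : world can_model) A).
Local Notation denotes_at w t o := (denotes (M := can_model) cls (Some w : world can_model) t o).

Lemma sat_cls w A x y : K (IV y) -> {subset x :: fbv A <= B} ->
  sat_at w (fsubst y x A) <->
  sat (M := can_model) (upd (M := can_model) cls x (cls y)) (Some w : world can_model) A.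
Proof.
move=> Ky hB; have [yB _] := saturated_clean K_sat Ky.
apply: (proj1 (sat_subst can_model y x)); apply: contra (yB y _); last by rewrite inE.
by move=> yA; apply: hB; rewrite inE yA orbT.
Qed.

(** Two implications and no equivalence, since a formula may lie on neither side. Formulas and
    denotation formulas are handled together because abstracts contain terms and descriptions
    contain formulas. *)
Lemma truth n :
  (forall A, fsize A < n -> forall w,
     (left w A -> sat_at w A) /\ (right w A -> ~ sat_at w A)) /\
  (forall t, tsize t < n -> forall x w,
     (K (IL (LD t x w)) -> denotes_at w t (cls x)) /\
     (K (IR (Den t x w)) -> ~ denotes_at w t (cls x))).
Proof.
elim: n => [|n [IHf IHt]]; first by split.
have fL A w : fsize A < n -> left w A -> sat_at w A by move=> h; case: (IHf A h w).
have fR A w : fsize A < n -> right w A -> ~ sat_at w A by move=> h; case: (IHf A h w).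
have sL A x y w : fsize A < n -> left w (fsubst y x A) -> sat_at w (fsubst y x A).
  by move=> h; apply: fL; rewrite (proj1 (size_subst S y x)).
have sR A x y w : fsize A < n -> right w (fsubst y x A) -> ~ sat_at w (fsubst y x A).
  by move=> h; apply: fR; rewrite (proj1 (size_subst S y x)).
have szl a b : (a + b).+1 < n.+1 -> a < n by apply: leq_ltn_trans (leq_addr _ _).
have szr a b : (a + b).+1 < n.+1 -> b < n by apply: leq_ltn_trans (leq_addl _ _).
split.
- case=> [P xs|y z||A1 A2|A1 A2|A1 A2|x A|x A|A|A|x A t] /= sz w; split=> h.
  + by exists xs.
  (* The interpretation may be witnessed by other representatives [ys] of the same classes;
     replacement leads back to [xs]. *)
  + case=> ys hy e; apply: (saturated_atomic K_sat (atomic_Atom xs) _ h).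
    apply: (Atom_eqv _ hy) => i; apply: cls_inj.
    * by apply: K_var hy _; apply: mem_tnth.
    * by apply: K_var h _; apply: mem_tnth.
    * by have := f_equal (fun os => tnth os i) e; rewrite !tnth_map.
  + by apply: cls_eq; exists w.
  + move=> e; apply: (saturated_atomic K_sat (atomic_Eq S y z) _ h).
    apply: eqv_at (K_right_label h) _; apply: cls_inj e;
    by apply: K_var h _; rewrite !inE eqxx ?orbT.
  + by case: (saturated_Bot K_sat h).
  + by [].
  + by have [h1 h2] := K_resolved h erefl; split; apply: fL; eauto.
  + by case=> s1 s2; case: (K_resolved h erefl) => [/fR|/fR]; apply; eauto.
  + by case: (K_resolved h erefl) => [/fL|/fL] h'; [left|right]; apply: h'; eauto.
  + by have [h1 h2] := K_resolved h erefl; case; apply: fR; eauto.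
  + by move=> s1; case: (K_resolved h erefl) => [/fR|/fL] h'; [case: h'|apply: h']; eauto.
  + by have [h1 h2] := K_resolved h erefl => s; apply: (fR A2 w _ h2); eauto.
  + move=> o /(_ (K_left_label h))[y yw ->].
    have Ky : K (IV y) by apply: K_var yw _; rewrite inE.
    apply/sat_cls => //; first exact: (proj2 (saturated_clean K_sat h)).
    by apply: sL => //; apply: (proj2 (K_req yw h)).
  + have [z zw hz] := K_resolved h erefl => s; apply: (sR A x z w _ hz) => //.
    have Kz : K (IV z) by apply: K_var zw _; rewrite inE.
    apply/sat_cls => //; first exact: (proj2 (saturated_clean K_sat h)).
    by apply: s; exists z.
  + have [z zw hz] := K_resolved h erefl; exists (cls z); first by exists z.
    have Kz : K (IV z) by apply: K_var zw _; rewrite inE.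
    by apply/sat_cls => //; [exact: (proj2 (saturated_clean K_sat h))|exact: sL].
  + case=> o /(_ (K_right_label h))[y yw ->].
    have Ky : K (IV y) by apply: K_var yw _; rewrite inE.
    move/sat_cls => s; apply: (sR A x y w) => //.
      exact: (proj2 (K_req yw h)).
    by apply: s => //; apply: (proj2 (saturated_clean K_sat h)).
  + move=> v /(can_accP (K_left_label h))[u -> wu]; apply: fL => //.
    exact: (proj2 (K_req wu h)).
  + have [u wu hu] := K_resolved h erefl => s; apply: (fR A u _ hu) => //.
    by apply: s; left.
  + have [u wu hu] := K_resolved h erefl; exists (Some u); first by left.
    exact: fL.
  + case=> v /(can_accP (K_right_label h))[u -> wu]; apply: fR => //.
    exact: (proj2 (K_req wu h)).
  + have [z zt hz] := K_resolved h erefl; exists (cls z).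
      by apply: (proj1 (IHt t (szr _ _ sz) z w)).
    have Kz : K (IV z) by apply: K_var zt _; rewrite inE eqxx.
    apply/sat_cls => //; last by apply: sL hz; eauto.
    exact: (proj2 (proj1 (clean_Lam (saturated_clean K_sat h)))).
  (* Every object is the class of an occurring variable, and [RLam] has been applied with that
     variable. *)
  + case=> o; have [y Ky ->] := vclass_cls o => d s.
    case: (proj2 (K_req h Ky)) => h'.
      exact: (proj2 (IHt t (szr _ _ sz) y w) h' d).
    apply: (sR A x y w) h' _; first by eauto.
    apply/sat_cls => //.
    exact: (proj2 (proj1 (clean_Lam (saturated_clean K_sat h : clean B (IL (LL w (Lam x A t))))))).
- case=> [y|y A] /= sz x w; split=> h.
  + have Kw : K (IW w) by apply: K_label h _; rewrite inE.
    by apply: cls_eq; exists w; apply: (proj2 (K_req h Kw)).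
  + move=> e; have Kw : K (IW w) by apply: K_label h _; rewrite inE.
    have Kx : K (IV x) by apply: K_var h _; rewrite inE eqxx.
    have Ky : K (IV y) by apply: K_var h _; rewrite !inE eqxx orbT.
    (* [DenVar] gives the formula with [y] in both places; [Repl] along [y = x] turns its second
       argument into [x]. *)
    apply: (saturated_Den K_sat) h; have [_ yy _] := proj2 (K_req Kw Ky).
    exact: (proj2 (K_req (eqv_at Kw (cls_inj Ky Kx e)) yy)).
  + have Kw : K (IW w) by apply: K_label h _; rewrite inE.
    have Kx : K (IV x) by apply: K_var h _; rewrite inE eqxx.
    have hB := proj2 (saturated_clean K_sat h).
    split; first by apply/sat_cls => //; apply: sL => //; apply: (proj2 (K_req h Kw)).
    (* Uniqueness: [LD2] at [z] puts the instance on the right, contrary to [s], or else the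
       equation of [x] and [z] on the left. *)
    move=> o; have [z Kz ->] := vclass_cls o => /(sat_cls w Kz hB) s.
    case: (proj2 (K_req h Kz)) => h'; first by case: (sR A y z w sz h').
    by apply: cls_eq; apply: eqv_sym; exists w.
  + have Kx : K (IV x) by apply: K_var h _; rewrite inE eqxx.
    have hB := proj2 (saturated_clean K_sat h).
    case=> s1 s2; case: (K_resolved h erefl) => [/sR|[z hz hr]].
      by apply=> //; apply/sat_cls.
    have Kz : K (IV z) by apply: K_var hr _; rewrite !inE eqxx orbT.
    apply: (saturated_atomic K_sat (atomic_Eq S x z) _ hr).
    apply: eqv_at (K_right_label hr) _; apply: cls_inj => //; symmetry.
    by apply: s2; apply/sat_cls => //; apply: sL.
Qed.

Lemma truth_left e : K (IL e) -> aexpr_sat (M := can_model) Some cls e.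
Proof.
case: e => [[w A|t x w]|x w|w v] h.
- exact: (proj1 (proj1 (truth (fsize A).+1) A (ltnSn _) w)).
- apply/sexpr_sat_Den.
  exact: (proj1 (proj2 (truth (tsize t).+1) t (ltnSn _) x w)).
- by move=> _; exists x.
- by left.
Qed.

Lemma truth_right e : K (IR e) -> ~ sexpr_sat (M := can_model) Some cls e.
Proof.
case: e => [w A|t x w] h.
  exact: (proj2 (proj1 (truth (fsize A).+1) A (ltnSn _) w)).
move/sexpr_sat_Den.
exact: (proj2 (proj2 (truth (tsize t).+1) t (ltnSn _) x w)).
Qed.

End CanonicalModel.

(** * Passage to a pure variant, and completeness *)

Lemma sequent_pure_variant (S : signature) (V L : eqType)
    (V_infinite : infinite_type V) (s : sequent S V L) :
  exists2 s', sequent_alpha s s' & pure s'.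
Proof.
(* Binders of each expression must avoid the free variables of the whole sequent; as renaming adds
   no free variables, the expressions can be treated separately. *)
pose F := sequent_fv s.
have sv (e : sexpr S V L) : exists e', [/\ salpha e e', {subset sexpr_fv e' <= sexpr_fv e}
    & forall z, z \in sexpr_bv e' -> z \notin F].
  case: e => [w A|t x w].
    have [A' [aA sA bA]] := proj1 (pure_variant S V_infinite F) A.
    by exists (Lab w A'); split=> //; constructor.
  have [t' [aT sT bT]] := proj2 (pure_variant S V_infinite F) t.
  exists (Den t' x w); split=> //; first by constructor.
  by move=> z; rewrite !inE => /orP[->//|/sT ->]; rewrite orbT.
have av (e : aexpr S V L) : exists e', [/\ aalpha e e', {subset aexpr_fv e' <= aexpr_fv e}
    & forall z, z \in aexpr_bv e' -> z \notin F].
  case: e => [e|x w|w v].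
  - by have [e' [? ? ?]] := sv e; exists (Inj e'); split=> //; constructor.
  - by exists (Mem x w); split=> //; constructor.
  - by exists (Rel w v); split=> //; constructor.
have lift (T : Type) (R : T -> T -> Prop) (fv bv : T -> seq V) (l : seq T) :
    (forall e, exists e', [/\ R e e', {subset fv e' <= fv e}
      & forall z, z \in bv e' -> z \notin F]) ->
    exists l', [/\ List.Forall2 R l l',
      {subset flatten (map fv l') <= flatten (map fv l)}
      & forall z, z \in flatten (map bv l') -> z \notin F].
  move=> h; elim: l => [|e l [l' [Rl sl bl]]]; first by exists [::].
  have [e' [Re se be]] := h e; exists (e' :: l'); split; first by constructor.
    by move=> z /=; rewrite !mem_cat => /orP[/se->|/sl->]; rewrite ?orbT.
  by move=> z /=; rewrite mem_cat => /orP[/be|/bl].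
have [G' [RG sG bG]] := lift _ _ _ _ s.1 av.
have [D' [RD sD bD]] := lift _ _ _ _ s.2 sv.
exists (G', D') => // x; rewrite /sequent_fv /sequent_bv /= => xf.
have xF : x \in F.
  by move: xf; rewrite /F /sequent_fv !mem_cat => /orP[/sG->|/sD->]; rewrite ?orbT.
by apply: contraL xF; rewrite mem_cat => /orP[/bG|/bD].
Qed.

(** This fixes [B] as the bound variables of the starting sequent. *)
Lemma pure_expr_clean (S : signature) (V L : eqType) (G : seq (aexpr S V L))
    (D : seq (sexpr S V L)) : pure (G, D) ->
  (forall e, List.In e G -> clean (sequent_bv (G, D)) (IL e)) /\
  (forall e, List.In e D -> clean (sequent_bv (G, D)) (IR e)).
Proof.
move=> p; split=> e he; split=> x xe.
- by apply: p; apply/sequent_fvP; left; exists e.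
- rewrite /sequent_bv mem_cat; apply/orP; left; apply/flattenP.
  by exists (aexpr_bv e) => //; apply/In_mem/List.in_map.
- by apply: p; apply/sequent_fvP; right; exists e.
- rewrite /sequent_bv mem_cat; apply/orP; right; apply/flattenP.
  by exists (sexpr_bv e) => //; apply/In_mem/List.in_map.
Qed.

Theorem mainTheorem2 (S : signature) (V L : eqType)
    (V_infinite : infinite_type V) (L_infinite : infinite_type L)
    (N : nlrule -> Prop) (G : seq (aexpr S V L)) (H : seq (sexpr S V L)) :
  valid N (G, H) -> derivable N (G, H).
Proof.
move=> vGH; have [[G' D'] aGH pGD] := sequent_pure_variant V_infinite (G, H).
exists (G', D') => //; apply: NNPP => nd.
have [cG cD] := pure_expr_clean pGD.
have [x0 x0B] := V_infinite (sequent_bv (G', D')).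
have [w0 _] := L_infinite [::].
have [K K_sat K0] := saturation V_infinite L_infinite (good_initial w0 nd cG cD x0B).
have inK a : List.In a (items G' D') -> K a.
  by move=> h; apply: K0; apply/List.in_app_iff; left.
have Kx0 : K (IV S L x0) by apply: K0; apply/List.in_app_iff; right; left.
have Kw0 : K (IW S V w0) by apply: K0; apply/List.in_app_iff; right; right; left.
(* The variant inherits validity, which is tested with labels read as themselves and variables as
   their classes. *)
have /(_ (can_model Kx0) (can_frame_property K_sat Kx0) Some (cls Kx0)) := valid_alpha aGH vGH.
case=> [|e eD se].
  by move=> e eG; apply: (truth_left K_sat Kx0 Kw0); apply/inK/In_items.
by apply: (truth_right K_sat Kw0 _ se); apply/inK/In_items.
Qed.
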